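(* Let $d\ge 2$ and $m\ge 1$ be integers with $\gcd(d,m)=1$, let $\Bbbk$ be a field, and let $\mathfrak p\subset R=\Bbbk[[x_1,\dots,x_d]]$ be the defining ideal of the monomial curve parametrized by $(t^{n_1},\dots,t^{n_d})$, $n_i=d+(i-1)m$. With $\mathcal I_n$, $I_n$, $T'$ and $LI$ as defined in the context: (1) For all $n\ge 1$, $\mathfrak p^{(n)}=\mathcal I_n R$. (2) For all $n\ge d$, $$\mathfrak p^{(n)}=\sum_{a_1+2a_2+\cdots+(d-1)a_{d-1}=n}\mathfrak p^{a_1}(\mathfrak p^{(2)})^{a_2}\cdots(\mathfrak p^{(d-1)})^{a_{d-1}},$$ the sum being over all $(a_1,\dots,a_{d-1})\in\mathbb Z_{\ge 0}^{d-1}$ with $a_1+2a_2+\cdots+(d-1)a_{d-1}=n$. (3) For all $n\ge 1$, $LI(\mathfrak p^{(n)}T')=I_n=LI(\mathcal I_nT')$.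
   Context: $\mathfrak p$ is the kernel of the $\Bbbk$-algebra map $R=\Bbbk[[x_1,\dots,x_d]]\to\Bbbk[[t]]$, $x_i\mapsto t^{n_i}$; the same letter denotes its polynomial version, the kernel of $T=\Bbbk[x_1,\dots,x_d]\to\Bbbk[t]$, $x_i\mapsto t^{n_i}$. The $n$-th symbolic power is $\mathfrak p^{(n)}=\mathfrak p^nR_{\mathfrak p}\cap R$ (respectively $\mathfrak p^nT_{\mathfrak p}\cap T$). $X=[X_{ij}]$ is the $d\times d$ matrix with $X_{ij}=x_{i+j-1}$ if $i+j\le d+1$ and $X_{ij}=x_1^m x_{i+j-d-1}$ if $i+j\ge d+2$. For $1\le i\le d-1$ and $1\le j_1<\cdots<j_{i+1}\le d$ let $X_{i+1,(j_1,\dots,j_{i+1})}$ be the submatrix of $X$ formed by the first $i+1$ rows and the columns $j_1,\dots,j_{i+1}$. Let $\mathcal J_i$ be the set (and the ideal it generates) of all $\det X_{i+1,(j_1,\dots,j_{i+1})}$ with $1\le j_1<\cdots<j_{i+1}\le d$, and let $\mathcal I_n=\sum_{a_1+2a_2+\cdots+(d-1)a_{d-1}=n}\mathcal J_1^{a_1}\cdots\mathcal J_{d-1}^{a_{d-1}}$ (sum over nonnegative integers $a_i$), an ideal of $T$. $T'=T/(x_1)=\Bbbk[x_2,\dots,x_d]$; for an ideal $I$ of $T$, $IT'$ is its image in $T'$. In $T'$ let $J_i=(x_{i+1},\dots,x_d)^{i+1}$ for $1\le i\le d-1$ and $I_n=\sum_{a_1+2a_2+\cdots+(d-1)a_{d-1}=n}J_1^{a_1}\cdots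 J_{d-1}^{a_{d-1}}$. Monomial order on $T'$: $x_2^{a_2}\cdots x_d^{a_d}>x_2^{b_2}\cdots x_d^{b_d}$ if the total degree of the first is larger, or the total degrees are equal and the left-most nonzero entry of $(a_2-b_2,\dots,a_d-b_d)$ is negative. $LI(I)$ is the initial (leading) ideal of an ideal $I\subseteq T'$ with respect to this order. *)

(* Defs.v *)
From HB Require Import structures.
From mathcomp Require Import all_boot all_order all_algebra.
From mathcomp Require Import boolp classical_sets.
From mathcomp Require Import mpoly.

Set Implicit Arguments.
Unset Strict Implicit.
Unset Printing Implicit Defensive.

Import Order.TTheory GRing.Theory.

Local Open Scope ring_scope.

(* -------------------------------------------------------------------------- *)
(* Formal power series in n variables, represented by their coefficients.     *)
(* The product is the same convolution as for {mpoly K[n]} (mcoeffM).         *)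
(* -------------------------------------------------------------------------- *)

Record mps (n : nat) (K : Type) := Mps { mps_coef : 'X_{1..n} -> K }.

Section PowerSeriesRing.
Variables (n : nat) (K : fieldType).
Local Notation S := (mps n K).
Local Notation "f @[ m ]" := (mps_coef f m)
  (at level 2, format "f @[ m ]").

HB.instance Definition _ := gen_eqMixin S.
HB.instance Definition _ := gen_choiceMixin S.

Lemma mpsP (f g : S) : (forall m, f@[m] = g@[m]) -> f = g.
Proof. by case: f g => f [g] /= fg; congr Mps; apply/funext. Qed.

Definition mps_zero : S := Mps (fun=> 0).
Definition mps_opp (f : S) : S := Mps (fun m => - f@[m]).
Definition mps_add (f g : S) : S := Mps (fun m => f@[m] + g@[m]).
Definition mps_mul (f g : S) : S := Mps (fun m =>
  \sum_(k : 'X_{1..n < (mdeg m).+1, (mdeg m).+1} | m == (k.1 + k.2)%MM)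
    f@[k.1] * g@[k.2]).
Definition mps_of_mpoly (p : {mpoly K[n]}) : S := Mps (fun m => p@_m).

Fact mps_addA : associative mps_add.
Proof. by move=> f g h; apply: mpsP => m /=; rewrite addrA. Qed.
Fact mps_addC : commutative mps_add.
Proof. by move=> f g; apply: mpsP => m /=; rewrite addrC. Qed.
Fact mps_add0 : left_id mps_zero mps_add.
Proof. by move=> f; apply: mpsP => m /=; rewrite add0r. Qed.
Fact mps_addN : left_inverse mps_zero mps_opp mps_add.
Proof. by move=> f; apply: mpsP => m /=; rewrite addNr. Qed.

HB.instance Definition _ :=
  GRing.isZmodule.Build S mps_addA mps_addC mps_add0 mps_addN.

Definition mps_trunc (b : nat) (f : S) : {mpoly K[n]} :=
  \sum_(m : 'X_{1..n < b}) f@[m] *: 'X_[m].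

Lemma mcoeff_trunc b f m : (mdeg m < b)%N -> (mps_trunc b f)@_m = f@[m].
Proof. exact: mcoeff_mpoly. Qed.

Lemma mcoeffM_low b (p p' q q' : {mpoly K[n]}) m : (mdeg m < b)%N ->
  (forall u, (mdeg u < b)%N -> p@_u = p'@_u) ->
  (forall u, (mdeg u < b)%N -> q@_u = q'@_u) ->
  (p * q)@_m = (p' * q')@_m.
Proof.
move=> mb pp qq; rewrite !mcoeffM; apply: eq_bigr => -[u v] _ /=.
by rewrite pp ?qq //; apply: leq_trans (bmdeg _) mb.
Qed.

Lemma mps_mulE b f g m : (mdeg m < b)%N ->
  (mps_mul f g)@[m] = (mps_trunc b f * mps_trunc b g)@_m.
Proof.
move=> mb; rewrite mcoeffM /=; apply: eq_bigr => -[u v] _ /=.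
by rewrite !mcoeff_trunc //; apply: leq_trans (bmdeg _) mb.
Qed.

Lemma mps_mulE_low b f g p q m : (mdeg m < b)%N ->
  (forall u, (mdeg u < b)%N -> f@[u] = p@_u) ->
  (forall u, (mdeg u < b)%N -> g@[u] = q@_u) ->
  (mps_mul f g)@[m] = (p * q)@_m.
Proof.
move=> mb fp gq; rewrite (mps_mulE f g mb).
by apply: (mcoeffM_low mb) => u ub; rewrite mcoeff_trunc ?fp ?gq.
Qed.

Fact mps_mulA : associative mps_mul.
Proof.
move=> f g h; apply: mpsP => m; set b := (mdeg m).+1.
have mb : (mdeg m < b)%N by [].
have tr k u : (mdeg u < b)%N -> k@[u] = (mps_trunc b k)@_u.
  by move=> ?; rewrite mcoeff_trunc.
rewrite (mps_mulE_low mb (tr f) (fun u ub => mps_mulE g h ub)).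
by rewrite (mps_mulE_low mb (fun u ub => mps_mulE f g ub) (tr h)) mulrA.
Qed.

Fact mps_mulC : commutative mps_mul.
Proof.
move=> f g; apply: mpsP => m.
by rewrite !(@mps_mulE (mdeg m).+1) // mulrC.
Qed.

Fact mps_mul1 : left_id (mps_of_mpoly 1) mps_mul.
Proof.
move=> f; apply: mpsP => m; have mb : (mdeg m < (mdeg m).+1)%N by [].
rewrite (@mps_mulE_low _ _ _ 1 (mps_trunc (mdeg m).+1 f) _ mb) //.
  by rewrite mul1r mcoeff_trunc.
by move=> u ub; rewrite mcoeff_trunc.
Qed.

Fact mps_mulD : left_distributive mps_mul mps_add.
Proof.
move=> f g h; apply: mpsP => m /=; rewrite -big_split /=.
by apply: eq_bigr => k _; rewrite mulrDl.
Qed.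

Fact mps_one_neq0 : mps_of_mpoly 1 != 0 :> S.
Proof.
apply/eqP => /(congr1 (fun f : S => f@[0%MM])) /= /eqP.
by rewrite mcoeff1 eqxx oner_eq0.
Qed.

HB.instance Definition _ := GRing.Zmodule_isComNzRing.Build S
  mps_mulA mps_mulC mps_mul1 mps_mulD mps_one_neq0.

Lemma mps_of_mpoly_is_zmod_morphism : zmod_morphism mps_of_mpoly.
Proof. by move=> p q; apply: mpsP => m /=; rewrite mcoeffB. Qed.

Lemma mps_of_mpoly_is_monoid_morphism : monoid_morphism mps_of_mpoly.
Proof.
split=> // p q; apply: mpsP => m.
by rewrite (@mps_mulE_low (mdeg m).+1 _ _ p q).
Qed.

HB.instance Definition _ := GRing.isZmodMorphism.Build {mpoly K[n]} S
  mps_of_mpoly mps_of_mpoly_is_zmod_morphism.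
HB.instance Definition _ := GRing.isMonoidMorphism.Build {mpoly K[n]} S
  mps_of_mpoly mps_of_mpoly_is_monoid_morphism.

Definition mps_unit : pred S := fun f => `[< exists g, g * f = 1 >].
Definition mps_inv (f : S) : S :=
  if pselect (exists g, g * f = 1) is left h then projT1 (cid h) else f.

Fact mps_mulV : {in mps_unit, left_inverse 1 mps_inv *%R}.
Proof.
move=> f /asboolP uf; rewrite /mps_inv; case: pselect => // h.
by case: (cid h).
Qed.
Fact mps_unitP (f g : S) : g * f = 1 -> mps_unit f.
Proof. by move=> gf; apply/asboolP; exists g. Qed.
Fact mps_invr_out : {in [predC mps_unit], mps_inv =1 id}.
Proof.
by move=> f /asboolPn nf; rewrite /mps_inv; case: pselect.
Qed.

HB.instance Definition _ := GRing.ComNzRing_hasMulInverse.Build S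
  mps_mulV mps_unitP mps_invr_out.

Lemma mps_minimal (f : S) : f != 0 ->
  exists2 u, f@[u] != 0 & forall v, (v < u)%O -> f@[v] = 0.
Proof.
move=> f0; apply: contrapT => h; case/negP: f0; apply/eqP/mpsP => m /=.
elim/(well_founded_ind (@ltom_wf n)): m => u ih; apply/eqP.
by apply: contrapT => /negP fu; apply: h; exists u.
Qed.

Fact mps_integral (f g : S) : f * g = 0 -> (f == 0) || (g == 0).
Proof.
move=> fg; apply: contrapT => /negP; rewrite negb_or => /andP[].
move=> /mps_minimal[u fu ul] /mps_minimal[v gv vl].
have: (f * g)@[(u + v)%MM] = 0 by rewrite fg.
rewrite /GRing.mul /=.
have ub : (mdeg u < (mdeg (u + v)%MM).+1)%N by rewrite mdegD ltnS leq_addr.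
have vb : (mdeg v < (mdeg (u + v)%MM).+1)%N by rewrite mdegD ltnS leq_addl.
rewrite (bigD1 (BMultinom ub, BMultinom vb)) //= big1 ?addr0.
  by move/eqP; rewrite mulf_eq0 (negPf fu) (negPf gv).
move=> -[[a ab] [c cb]] /= /andP[/eqP e ne].
case: (ltP a u) => [/ul -> | ua]; first by rewrite mul0r.
case: (ltP c v) => [/vl -> | vc]; first by rewrite mulr0.
case/negP: ne; apply/eqP.
have au : a = u.
  apply/eqP; apply: contrapT => /negP; rewrite eq_sym => nua.
  have lt : (u < a)%O by rewrite lt_neqAle nua.
  by have := ltmc_le_add lt vc; rewrite e ltxx.
have cv : c = v by move: e; rewrite au => /addmI.
by congr (_, _); apply: val_inj.
Qed.

HB.instance Definition _ :=
  GRing.ComUnitRing_isIntegral.Build S mps_integral.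

End PowerSeriesRing.

(* -------------------------------------------------------------------------- *)
(* The K-algebra map x_i |-> t^(w i) from K[[x_1, ..., x_n]] to K[[t]], and   *)
(* its restriction from K[x_1, ..., x_n] to K[t]. Here K[[t]] is mps 1 K and  *)
(* K[t] is {mpoly K[1]}. The coefficient of t^e in the image of a series f is *)
(* the sum of the coefficients of f at the monomials of weight e; when all    *)
(* the w i are positive such monomials have degree at most e, so the sum in   *)
(* mps_curve is complete. The lemmas below check that it is this ring map.    *)
(* -------------------------------------------------------------------------- *)

Section MonomialCurveMap.
Variables (n : nat) (K : fieldType) (w : 'I_n -> nat).

Definition mps_curve (f : mps n K) : mps 1 K := Mps (fun e =>
  \sum_(m : 'X_{1..n < (mdeg e).+1} | (\sum_(i < n) m i * w i)%N == mdeg e)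
    mps_coef f m).

Definition mpoly_curve : {mpoly K[n]} -> {mpoly K[1]} :=
  mmap (@mpolyC 1 K) (fun i => 'X_ord0 ^+ w i).

Hypothesis w_gt0 : forall i, (0 < w i)%N.

Lemma mps_curve_additive : zmod_morphism mps_curve.
Proof. by move=> f g; apply: mpsP => e /=; rewrite -sumrB. Qed.

Lemma mpoly_curveX m :
  mpoly_curve 'X_[m] = 'X_[U_(ord0) *+ (\sum_(i < n) m i * w i)].
Proof.
rewrite /mpoly_curve mmapX /mmap1.
under eq_bigr => i _ do rewrite -exprM mulnC.
by rewrite prodrXr mpolyXn.
Qed.

Lemma mdeg1_eq (u v : 'X_{1..1}) : (u == v) = (mdeg u == mdeg v).
Proof.
apply/eqP/eqP => [-> // |]; rewrite !mdegE !big_ord1 => e.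
by apply/mnmP => i; rewrite ord1.
Qed.

Lemma mps_curve_mpoly (p : {mpoly K[n]}) :
  mps_curve (mps_of_mpoly p) = mps_of_mpoly (mpoly_curve p).
Proof.
elim/mpolyind: p => [|c m p _ _ IH].
  have -> : mps_of_mpoly 0 = 0 :> mps n K by rewrite rmorph0.
  rewrite /mpoly_curve mmap0 rmorph0.
  by apply: mpsP => e /=; rewrite big1.
have -> : mps_of_mpoly (c *: 'X_[m] + p) =
   mps_of_mpoly (c *: 'X_[m]) - (- mps_of_mpoly p) by rewrite opprK rmorphD.
rewrite mps_curve_additive -[- mps_of_mpoly p]sub0r mps_curve_additive.
have -> : mps_curve 0 = 0 by apply: mpsP => e /=; rewrite big1.
rewrite sub0r opprK IH /mpoly_curve mmapD rmorphD /=; congr (_ + _).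
rewrite mmapZ -/mpoly_curve -/(mpoly_curve 'X_[m]) mpoly_curveX.
apply: mpsP => e /=; rewrite mcoeffCM mcoeffX mdeg1_eq mdegMn mdeg1 mul1n.
case: eqP => [ew | new].
  have mb : (mdeg m < (mdeg e).+1)%N.
    rewrite ltnS -ew mdegE; apply: leq_sum => i _.
    by rewrite leq_pmulr.
  rewrite (bigD1 (BMultinom mb)) /= ?ew //.
  rewrite mcoeffZ mcoeffX eqxx big1 ?addr0 // => u /andP[_ um].
  rewrite mcoeffZ mcoeffX; case: eqP => [mu | _]; last by rewrite mulr0.
  by case/negP: um; apply/eqP/val_inj.
rewrite mulr0 big1 // => u /eqP eu; rewrite mcoeffZ mcoeffX.
by case: eqP => [mu | _]; rewrite ?mulr0 //; case: new; rewrite mu.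
Qed.

Lemma mps_curve_low b (f g : mps n K) e : (mdeg e < b)%N ->
  (forall u, (mdeg u < b)%N -> mps_coef f u = mps_coef g u) ->
  mps_coef (mps_curve f) e = mps_coef (mps_curve g) e.
Proof.
move=> eb fg /=; apply: eq_bigr => u _.
by apply: fg; apply: leq_trans (bmdeg _) eb.
Qed.

Lemma mps_curve_multiplicative : monoid_morphism mps_curve.
Proof.
split=> [|f g].
  by rewrite -[1]/(mps_of_mpoly 1) mps_curve_mpoly /mpoly_curve rmorph1.
apply: mpsP => e; set b := (mdeg e).+1; have eb : (mdeg e < b)%N by [].
pose tf := mps_trunc b f; pose tg := mps_trunc b g.
have lowtr (h : mps n K) u : (mdeg u < b)%N ->
    mps_coef (mps_curve h) u = (mpoly_curve (mps_trunc b h))@_u.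
  move=> ub.
  rewrite -[RHS]/(mps_coef (mps_of_mpoly (mpoly_curve (mps_trunc b h))) u).
  rewrite -mps_curve_mpoly; apply: (mps_curve_low ub) => v vb /=.
  by rewrite mcoeff_trunc.
rewrite (mps_mulE_low eb (lowtr f) (lowtr g)).
rewrite -[RHS]/(mps_coef (mps_of_mpoly (_ * _)) e) -rmorphM -mps_curve_mpoly.
apply: (mps_curve_low eb) => v vb; exact: mps_mulE.
Qed.

Lemma mps_curveX i :
  mps_curve (mps_of_mpoly 'X_i) = mps_of_mpoly ('X_ord0 ^+ w i).
Proof. by rewrite mps_curve_mpoly /mpoly_curve mmapX mmap1U. Qed.

End MonomialCurveMap.

(* -------------------------------------------------------------------------- *)
(* Ideals, as sets of ring elements.                                          *)
(* -------------------------------------------------------------------------- *)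

Local Open Scope classical_set_scope.

Section Ideals.
Variable A : comNzRingType.
Implicit Types S I J : set A.

Definition idgen S : set A := [set f |
  exists k (c g : 'I_k -> A), (forall i, S (g i)) /\ f = \sum_(i < k) c i * g i].

Definition idmul I J : set A :=
  idgen [set h | exists f g, [/\ I f, J g & h = f * g]].

Definition idexp I (n : nat) : set A := iter n (idmul I) setT.

(* The ideal \sum_(a_1 + 2 a_2 + ... + r a_r = n) (J 1)^a_1 ... (J r)^a_r;    *)
(* the index i : 'I_r stands for i + 1.                                       *)
Definition weighted_sum (r : nat) (J : nat -> set A) (n : nat) : set A :=
  idgen [set f | exists a : 'I_r -> nat,
    (\sum_(i < r) i.+1 * a i)%N = n /\
    (\big[idmul/setT]_(i < r) idexp (J i.+1) (a i)) f].

End Ideals.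

(* Extension of an ideal along a ring map. *)
Definition idext (A B : comNzRingType) (phi : A -> B) (I : set A) : set B :=
  idgen (phi @` I).

(* The localization A_P of a domain at a prime P is viewed inside Frac A.     *)
Section SymbolicPowers.
Variables (A : idomainType) (P : set A).
Local Notation "a %:F" := (tofrac a).

Definition localization : set {fraction A} :=
  [set z | exists r s, ~ P s /\ z = r%:F / s%:F].

Definition idloc (I : set A) : set {fraction A} := [set z |
  exists k (c : 'I_k -> {fraction A}) (a : 'I_k -> A),
    [/\ forall i, localization (c i), forall i, I (a i)
      & z = \sum_(i < k) c i * (a i)%:F]].

Definition symbolic_power (n : nat) : set A :=
  [set f | idloc (idexp P n) f%:F].

End SymbolicPowers.

(* -------------------------------------------------------------------------- *)
(* Initial ideals.                                                            *)
(* -------------------------------------------------------------------------- *)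

Section InitialIdeal.
Variables (n : nat) (K : fieldType).

(* u > v: larger degree, or equal degrees and the left-most nonzero entry of  *)
(* u - v is negative. This is neither of the orders predefined in mpoly.      *)
Definition mon_gt (u v : 'X_{1..n}) : Prop :=
  (mdeg v < mdeg u)%N \/
  (mdeg u = mdeg v /\
   exists2 k : 'I_n, (forall j : 'I_n, (j < k)%N -> u j = v j) & (u k < v k)%N).

Definition is_leading_monomial (f : {mpoly K[n]}) (u : 'X_{1..n}) : Prop :=
  u \in msupp f /\ forall v, v \in msupp f -> v != u -> mon_gt u v.

Definition LI (I : set {mpoly K[n]}) : set {mpoly K[n]} :=
  idgen [set g | exists f u, [/\ I f, is_leading_monomial f u & g = 'X_[u]]].

End InitialIdeal.

(* -------------------------------------------------------------------------- *)
(* The ideals attached to the curve (t^(n_1), ..., t^(n_d)).                  *)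
(* All indices are shifted by one: 'X_i in {mpoly K[d]} is x_(i+1), and 'X_i  *)
(* in {mpoly K[d.-1]} is x_(i+2).                                             *)
(* -------------------------------------------------------------------------- *)

(* 'X_k for k < n, and 0 for out of range k. *)
Definition mvar (n : nat) (K : fieldType) (k : nat) : {mpoly K[n]} :=
  if insub k is Some i then 'X_(i : 'I_n) else 0.

Section Curve.
Variables (K : fieldType) (d m : nat).

Definition curve_weight (i : 'I_d) : nat := (d + i * m)%N.

Definition pR : set (mps d K) := [set f | mps_curve curve_weight f = 0].

Definition pT : set {mpoly K[d]} := [set f | mpoly_curve curve_weight f = 0].

Definition Xmat : 'M[{mpoly K[d]}]_d := \matrix_(i, j)
  if (i + j < d)%N then mvar d K (i + j)
  else mvar d K 0 ^+ m * mvar d K (i + j - d).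

(* The row map r is forced to select the first i + 1 rows; meaningful only    *)
(* for 1 <= i < d (there is no such r when i >= d).                           *)
Definition calJ (i : nat) : set {mpoly K[d]} := idgen [set f |
  exists r c : 'I_i.+1 -> 'I_d,
    [/\ forall k, r k = k :> nat,
        forall k l : 'I_i.+1, (k < l)%N -> (c k < c l)%N
      & f = \det (mxsub r c Xmat)]].

Definition calI (n : nat) : set {mpoly K[d]} := weighted_sum d.-1 calJ n.

(* The quotient map T -> T' = T/(x_1) = K[x_2, ..., x_d]. *)
Definition modx1 : {mpoly K[d]} -> {mpoly K[d.-1]} :=
  mmap (@mpolyC d.-1 K)
       (fun i : 'I_d => if i == 0 :> nat then 0 else mvar d.-1 K i.-1).

Definition JT' (i : nat) : set {mpoly K[d.-1]} :=
  idexp (idgen [set f | exists2 k : 'I_d.-1, (i <= k.+1)%N & f = 'X_k]) i.+1.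

Definition IT' (n : nat) : set {mpoly K[d.-1]} := weighted_sum d.-1 JT' n.

End Curve.

Arguments pR : clear implicits.
Arguments pT : clear implicits.
Arguments calI : clear implicits.
Arguments IT' : clear implicits.

(* Main.v *)
(* Give x_i the weight d + (i - 1)m.  A weighted homogeneous f of p^(n) vanishes
   to order n at (1, ..., 1).  Deforming that point to (z_1, ..., z_d), where
   z_i is (1 + y_1)^(alpha + (i - 1) delta), multiplied by 1 + y_(i-1) if i >= 3,
   and d delta = m alpha + 1, gives a map theta from T to k[y_1, ..., y_(d-1)] with
   theta (p^(n)) in (y)^n that, in every characteristic, sends the part of T of
   any large enough weight onto k[y] / (y)^n.
     The monomials of T' outside I_n are written greedily as products of blocks;
   the final state of the process and the weights gained by each variable encode
   them by pairs (c, v) with c < d and v a monomial of degree < n in d - 1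
   variables.  The minors of the Hankel matrix have their antidiagonals as initial
   terms modulo x_1, so by induction on the weight these monomials span
   T / calI_n over k[x_1].
     There are at most d * dim (k[y] / (y)^n) of them, while their images fill
   k[y] / (y)^n for each of the d residues of weights mod d.  Hence they stay
   independent modulo any homogeneous element that theta sends to (y)^n, and
   every such element is in calI_n.  This gives p^(n) = calI_n in T, the equality
   in R by taking weighted components, and the initial ideals by reducing the
   non-leading terms. *)
Require Import Defs.
From HB Require Import structures.
From mathcomp Require Import all_boot all_order all_algebra.
From mathcomp Require Import boolp classical_sets.
From mathcomp Require Import fingroup perm mpoly zify ring.

Set Implicit Arguments.
Unset Strict Implicit.
Unset Printing Implicit Defensive.

Import Order.TTheory GRing.Theory.

Local Open Scope ring_scope.
Local Open Scope classical_set_scope.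

(** * Ideals, filtrations and symbolic powers *)

Section IdealTheory.
Variable A : comNzRingType.
Implicit Types S I J P : set A.

Definition is_ideal I := [/\ I 0, forall f g, I f -> I g -> I (f + g)
  & forall a f, I f -> I (a * f)].

Lemma ideal_sum I (T : Type) (r : seq T) (P : pred T) (F : T -> A) :
  is_ideal I -> (forall i, P i -> I (F i)) -> I (\sum_(i <- r | P i) F i).
Proof. by case=> I0 ID _ IF; elim/big_ind: _. Qed.

Lemma idealN I f : is_ideal I -> I f -> I (- f).
Proof. by case=> _ _ IM If; rewrite -mulN1r; apply: IM. Qed.

Lemma idealB I f g : is_ideal I -> I f -> I g -> I (f - g).
Proof. by move=> HI If Ig; case: (HI) => _ ID _; apply: ID => //; apply: idealN. Qed.

Lemma idealMr I a f : is_ideal I -> I f -> I (f * a).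
Proof. by case=> _ _ IM If; rewrite mulrC; apply: IM. Qed.

Lemma setT_ideal : is_ideal setT. Proof. by []. Qed.

Lemma idgen_ideal S : is_ideal (idgen S).
Proof.
split.
- by exists 0%N, (fun=> 0), (fun=> 0); split=> [[]//|]; rewrite big_ord0.
- move=> _ _ [k [c [g [Sg ->]]]] [l [c' [g' [Sg' ->]]]].
  exists (k + l)%N, (fun i => match split i with inl j => c j | inr j => c' j end).
  exists (fun i => match split i with inl j => g j | inr j => g' j end).
  split=> [i|]; first by case: splitP.
  rewrite big_split_ord; congr (_ + _); apply: eq_bigr => i _.
    by rewrite -[lshift l i]/(unsplit (inl i)) unsplitK.
  by rewrite -[rshift k i]/(unsplit (inr i)) unsplitK.
- move=> a _ [k [c [g [Sg ->]]]]; exists k, (fun i => a * c i), g; split=> //.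
  by rewrite mulr_sumr; apply: eq_bigr => i _; rewrite mulrA.
Qed.

Lemma sub_idgen S : S `<=` idgen S.
Proof.
move=> f Sf; exists 1%N, (fun=> 1), (fun=> f); split=> //.
by rewrite big_ord1 mul1r.
Qed.

Lemma idgen_sub S I : is_ideal I -> S `<=` I -> idgen S `<=` I.
Proof.
move=> HI SI _ [k [c [g [Sg ->]]]]; apply: ideal_sum => // i _.
by case: HI => _ _; apply; apply: SI.
Qed.

Lemma idmulM I J f g : I f -> J g -> idmul I J (f * g).
Proof. by move=> If Jg; apply: sub_idgen; exists f, g. Qed.

Lemma idmul_sub I J P : is_ideal P ->
  (forall f g, I f -> J g -> P (f * g)) -> idmul I J `<=` P.
Proof.
by move=> HP IJP; apply: idgen_sub => // _ [f [g [If Jg ->]]]; apply: IJP.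
Qed.

(** For fixed [g], the [x] with [x * g] in the target form an ideal, so it suffices to take [f],
    then [g], among generators. The same reduction recurs below. *)
Lemma idmul_idmulM I J I1 J1 I2 J2 f g :
  (forall x y, I x -> I1 y -> I2 (x * y)) ->
  (forall x y, J x -> J1 y -> J2 (x * y)) ->
  idmul I J f -> idmul I1 J1 g -> idmul I2 J2 (f * g).
Proof.
move=> II JJ IJf IJg; pose Q := [set x | idmul I2 J2 (x * g)].
have [id0 idD idM] := idgen_ideal [set h | exists f g, [/\ I2 f, J2 g & h = f * g]].
apply: (@idmul_sub I J Q _ _ f IJf) => [|x y Ix Jy]; rewrite /Q /=.
  split=> /= [|a b Ia Ib|a b Ib]; first by rewrite mul0r.
    by rewrite mulrDl; apply: idD.
  by rewrite -mulrA; apply: idM.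
pose Q' := [set z | idmul I2 J2 (x * y * z)].
apply: (@idmul_sub I1 J1 Q' _ _ g IJg) => [|z t Iz Jt]; rewrite /Q' /=.
  split=> /= [|a b Ia Ib|a b Ib]; first by rewrite mulr0.
    by rewrite mulrDr; apply: idD.
  by rewrite mulrCA; apply: idM.
by rewrite mulrACA; apply: idmulM; [apply: II | apply: JJ].
Qed.

Lemma idexp_ideal I n : is_ideal (idexp I n).
Proof. by case: n => [|n]; [apply: setT_ideal | apply: idgen_ideal]. Qed.

(** Ideal powers, symbolic powers, weighted sums and orders of vanishing all have this form;
    [idexp_least] and [weighted_sum_least] then reduce inclusions of powers and weighted sums to
    generators. *)
Definition filtration (F : nat -> set A) :=
  [/\ forall n, is_ideal (F n), forall f, F 0%N f
    & forall a b f g, F a f -> F b g -> F (a + b)%N (f * g)].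

Lemma idexp_filtration I : filtration (idexp I).
Proof.
split=> [n | // | a b]; first exact: idexp_ideal.
elim: a => [|a IH] f g.
  by move=> _ Ig; rewrite add0n; case: (idexp_ideal I b) => _ _; apply.
move=> Iaf Ibg; rewrite addSn /idexp /= -/(idexp I (a + b)) in Iaf *.
pose Q := [set x | idmul I (idexp I (a + b)) (x * g)].
have [id0 idD idM] := idexp_ideal I (a + b).+1.
apply: (@idmul_sub _ _ Q _ _ f Iaf) => [|x y Ix Iy]; rewrite /Q /=.
  split=> /= [|c e Ia Ib|c e Ib]; first by rewrite mul0r.
    by rewrite mulrDl; apply: idD.
  by rewrite -mulrA; apply: idM.
by rewrite -mulrA; apply: idmulM => //; apply: IH.
Qed.

Lemma idexp_least I F n : filtration F -> I `<=` F 1%N -> idexp I n `<=` F n.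
Proof.
move=> [Fid F0 FM] IF; elim: n => [|n IH] //= f.
apply: idmul_sub; first exact: Fid.
by move=> x y Ix Iy; rewrite -add1n; apply: FM; [apply: IF | apply: IH].
Qed.

Lemma idexp1 I : I `<=` idexp I 1.
Proof. by move=> f If; rewrite -[f]mulr1; apply: idmulM. Qed.

Lemma filtration_prod F (T : Type) (r : seq T) (n : T -> nat) (f : T -> A) :
  filtration F -> (forall i, F (n i) (f i)) ->
  F (\sum_(i <- r) n i)%N (\prod_(i <- r) f i).
Proof.
move=> [_ F0 FM] Ff; elim: r => [|i r IH]; rewrite ?big_nil ?big_cons //.
exact: FM.
Qed.

Variable r : nat.
Implicit Type X : nat -> set A.

Lemma big_idmulM (T : Type) (s : seq T) (I J L : T -> set A) f g :
  (forall i x y, I i x -> J i y -> L i (x * y)) ->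
  (\big[@idmul A/setT]_(i <- s) I i) f -> (\big[@idmul A/setT]_(i <- s) J i) g ->
  (\big[@idmul A/setT]_(i <- s) L i) (f * g).
Proof.
move=> IJL; elim: s f g => [|i s IH] f g; first by rewrite !big_nil.
by rewrite !big_cons; apply: idmul_idmulM; [apply: IJL | apply: IH].
Qed.

Lemma weighted_sum_filtration X : filtration (weighted_sum r X).
Proof.
split=> [n | f | a b f g fa gb]; first exact: idgen_ideal.
  apply: sub_idgen; exists (fun=> 0%N); split.
    by rewrite big1 // => i _; rewrite muln0.
  elim: (index_enum _) => [|i s IH]; rewrite ?big_nil ?big_cons //.
  by rewrite -[f]mul1r; apply: idmulM.
pose Q := [set x | weighted_sum r X (a + b) (x * g)].
have [id0 idD idM] : is_ideal (weighted_sum r X (a + b)) by exact: idgen_ideal.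
apply: (@idgen_sub _ Q _ _ f fa) => [|x [u [ua xu]]]; rewrite /Q /=.
  split=> /= [|c e Ia Ib|c e Ib]; first by rewrite mul0r.
    by rewrite mulrDl; apply: idD.
  by rewrite -mulrA; apply: idM.
pose Q' := [set z | weighted_sum r X (a + b) (x * z)].
apply: (@idgen_sub _ Q' _ _ g gb) => [|z [v [vb zv]]]; rewrite /Q' /=.
  split=> /= [|c e Ia Ib|c e Ib]; first by rewrite mulr0.
    by rewrite mulrDr; apply: idD.
  by rewrite mulrCA; apply: idM.
apply: sub_idgen; exists (fun i => u i + v i)%N; split.
  by rewrite -ua -vb -big_split; apply: eq_bigr => i _; rewrite mulnDr.
apply: big_idmulM xu zv => i s t.
by case: (idexp_filtration (X i.+1)) => _ _; apply.
Qed.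

Lemma weighted_sum_gen X i : (i < r)%N -> X i.+1 `<=` weighted_sum r X i.+1.
Proof.
move=> ir f Xf; apply: sub_idgen; exists (fun j => (j == i :> nat) : nat); split.
  rewrite (bigD1 (Ordinal ir)) //= eqxx muln1 big1 ?addn0 // => j ji.
  by rewrite (negPf (_ : j != i :> nat)) ?muln0.
have : f = \prod_(j < r) (if j == Ordinal ir then f else 1).
  by rewrite -big_mkcond big_pred1_eq.
move=> ->; elim: (index_enum _) => [|j s IH]; rewrite ?big_nil ?big_cons //.
apply: idmulM => //; case: (boolP (j == Ordinal ir)) => [/eqP -> /=|ji].
  by rewrite eqxx; apply: idexp1.
by rewrite (negPf (_ : j != i :> nat)).
Qed.

Lemma weighted_sum_least X F n : filtration F ->
  (forall i, (i < r)%N -> X i.+1 `<=` F i.+1) -> weighted_sum r X n `<=` F n.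
Proof.
move=> HF XF; have [Fid F0 FM] := HF; apply: idgen_sub; first exact: Fid.
move=> f [a [<-]]; elim: (index_enum _) f => [|i s IH] f.
  by rewrite !big_nil.
rewrite !big_cons; apply: idmul_sub; first exact: Fid.
move=> x y xi ys; apply: (FM); last exact: IH.
(* The indices divisible by [i.+1] form a filtration of their own, to which [idexp_least]
   applies. *)
pose G k := F (i.+1 * k)%N.
apply: (@idexp_least (X i.+1) G) xi.
  split=> [k|x'|k l x' y']; rewrite /G ?muln0 ?mulnDr //; exact: FM.
by rewrite /G muln1; apply: XF.
Qed.

End IdealTheory.

Lemma preimage_filtration (A B : comNzRingType) (phi : {rmorphism A -> B})
  (F : nat -> set B) : filtration F -> filtration (fun n => phi @^-1` F n).
Proof.
move=> [Fid F0 FM]; split=> [n|f|a b f g] /=.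
- have [I0 ID IM] := Fid n; split=> [|f g|a f] /=; first by rewrite rmorph0.
    by rewrite rmorphD; apply: ID.
  by rewrite rmorphM; apply: IM.
- exact: F0.
- by rewrite rmorphM; apply: FM.
Qed.

Section PrimeIdeals.
Variables (A : idomainType) (P : set A).

Definition is_prime :=
  [/\ is_ideal P, ~ P 1 & forall a b, P (a * b) -> P a \/ P b].

Hypothesis Pprime : is_prime.

Lemma prime_notM s t : ~ P s -> ~ P t -> ~ P (s * t).
Proof. by move=> Ps Pt; case: Pprime => _ _ PM /PM []. Qed.

(** Finitely many denominators have a common multiple outside the prime, so a single multiplier [s]
    replaces the localization. *)
Lemma symbolicP n f :
  symbolic_power P n f <-> exists2 s, ~ P s & idexp P n (s * f).
Proof.
have [[P0 PD PM] P1 _] := Pprime.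
have nz s : ~ P s -> tofrac s != 0.
  by move=> Ps; rewrite tofrac_eq0; apply/eqP => s0; apply: Ps; rewrite s0.
have [id0 idD idM] := idexp_ideal P n.
split=> [[k [c [a [cl aI fE]]]] | [s Ps sf]].
  pose Z (z : {fraction A}) :=
    exists s b, [/\ ~ P s, idexp P n b & z * tofrac s = tofrac b].
  have: Z (tofrac f).
    rewrite fE; apply: (big_ind Z).
    - by exists 1, 0; rewrite mul0r rmorph0.
    - move=> x y [s [b [Ps Ib xs]]] [t [b' [Pt Ib' yt]]].
      exists (s * t), (t * b + s * b'); split; first exact: prime_notM.
        by apply: idD; apply: idM.
      by rewrite rmorphD !rmorphM /= -xs -yt; ring.
    - move=> i _; have [x [s [Ps ->]]] := cl i.
      exists s, (x * a i); split=> //; first exact: idM.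
      by rewrite rmorphM mulrAC divfK // nz.
  move=> [s [b [Ps Ib]]]; rewrite -rmorphM => /eqP; rewrite tofrac_eq => /eqP fs.
  by exists s => //; rewrite mulrC fs.
exists 1%N, (fun=> 1 / tofrac s), (fun=> s * f); split=> //.
  by move=> _; exists 1, s; rewrite rmorph1.
by rewrite big_ord1 rmorphM mulrA divfK ?mul1r // nz.
Qed.

Lemma symbolic_filtration : filtration (symbolic_power P).
Proof.
have [HP P1 _] := Pprime.
split=> [n|f|a b f g /symbolicP[s Ps sf] /symbolicP[t Pt tg]].
- have [id0 idD idM] := idexp_ideal P n.
  split=> [|f g /symbolicP[s Ps sf] /symbolicP[t Pt tg]|a f /symbolicP[s Ps sf]].
  + by apply/symbolicP; exists 1; rewrite ?mulr0.
  + apply/symbolicP; exists (s * t); first exact: prime_notM.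
    by rewrite mulrDr -mulrA mulrCA -[s * t * g]mulrA; apply: idD; apply: idM.
  + by apply/symbolicP; exists s => //; rewrite mulrCA; apply: idM.
- by apply/symbolicP; exists 1.
- apply/symbolicP; exists (s * t); first exact: prime_notM.
  by rewrite mulrACA; case: (idexp_filtration P) => _ _; apply.
Qed.

Lemma symbolic1 : symbolic_power P 1 = P.
Proof.
have [HP P1 PM] := Pprime.
apply/seteqP; split=> f => [/symbolicP[s Ps]|Pf].
  move/(@idmul_sub _ P setT P HP (fun x y Px _ => idealMr y HP Px)).
  by case/PM.
by apply/symbolicP; exists 1 => //; rewrite mul1r; apply: idexp1.
Qed.

(* Multiplying row [k] of [M], [k > 0], by [x] and subtracting [a k] times row
   [0] puts it in [P]; this multiplies the determinant by [x ^+ i]. *)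
Lemma det_rank1_mod i (M : 'M[A]_i.+1) (x : A) (a : 'I_i.+1 -> A) :
  is_ideal P -> (forall k l, P (x * M k l - a k * M ord0 l)) ->
  idexp P i (x ^+ i * \det M).
Proof.
move=> HP MP.
pose L : 'M[A]_i.+1 := \matrix_(k, l)
  if k == ord0 then (l == ord0)%:R
  else if l == k then x else if l == ord0 then - a k else 0.
have Ltrig : is_trig_mx L.
  apply/is_trig_mxP => k l kl; rewrite mxE.
  have l0 : l != ord0 by apply: contraTneq kl => ->.
  have lk : l != k by apply: contraTneq kl => ->; rewrite ltnn.
  by rewrite (negPf l0) (negPf lk); case: ifP.
have -> : x ^+ i = \det L.
  rewrite det_trig // big_ord_recl mxE eqxx mul1r.
  rewrite (eq_bigr (fun=> x)) => [|k _]; first by rewrite prodr_const card_ord.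
  by rewrite mxE eqxx eq_sym (negPf (neq_lift _ _)).
(* Each Leibniz term of the product has [i] factors from the rows below row [0], all of them in
   [P]. *)
rewrite -det_mulmx /determinant; apply: ideal_sum; first exact: idexp_ideal.
move=> s _; case: (idexp_ideal P i) => _ _; apply.
rewrite big_ord_recl; case: (idexp_ideal P i) => _ _; apply.
have := @filtration_prod A (idexp P) _ (index_enum 'I_i) (fun=> 1%N)
  (fun k => (L *m M) (lift ord0 k) (s (lift ord0 k))) (idexp_filtration P).
rewrite (_ : \sum_(_ <- _) 1 = i)%N; last first.
  by rewrite big_const_seq count_predT /index_enum -enumT size_enum_ord iter_addn mul1n addn0.
apply=> k; apply: idexp1.
have k0 : (lift ord0 k == ord0) = false by rewrite eq_sym (negPf (neq_lift _ _)).
have k1 : (ord0 == lift ord0 k) = false by rewrite eq_sym.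
rewrite mxE (bigD1 (lift ord0 k)) //= (bigD1 ord0) ?k1 //=.
rewrite [L _ _]mxE k0 eqxx [L _ ord0]mxE k0 k1 eqxx big1 => [|l /andP[lk l0]].
  by rewrite addr0 mulNr.
by rewrite mxE k0 (negPf lk) (negPf l0) mul0r.
Qed.

End PrimeIdeals.

(** * Weighted components of power series and the order along the curve *)

Section Order.
Variables (n : nat) (K : fieldType).
Implicit Types p q h : {mpoly K[n]}.

Definition ord_ge (j : nat) h := forall u, (mdeg u < j)%N -> h@_u = 0.

Lemma ord_ge_ideal j : is_ideal (ord_ge j).
Proof.
split=> [u _|p q hp hq u uj|p h hh u uj]; first by rewrite mcoeff0.
  by rewrite mcoeffD hp // hq // addr0.
rewrite mcoeffM big1 // => -[a b] /= /eqP ub.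
by rewrite (hh b) ?mulr0 //; have := congr1 mdeg ub; rewrite mdegD; lia.
Qed.

Lemma ord_geM i j p q : ord_ge i p -> ord_ge j q -> ord_ge (i + j) (p * q).
Proof.
move=> hp hq u uij; rewrite mcoeffM big1 // => -[a b] /= /eqP ub.
have [ai|ia] := ltnP (mdeg a) i; first by rewrite hp // mul0r.
by rewrite hq ?mulr0 //; have := congr1 mdeg ub; rewrite mdegD; lia.
Qed.

(** A nonconstant monomial of [p] would leave for [h] a monomial of degree below [j], where [h] has
    no coefficient. *)
Lemma mcoeffM_lowest j p h u : ord_ge j h -> mdeg u = j ->
  (p * h)@_u = p@_0%MM * h@_u.
Proof.
move=> hh uj; rewrite mcoeffM.
have u0 : (mdeg (0%MM : 'X_{1..n}) < (mdeg u).+1)%N by rewrite mdeg0.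
rewrite (bigD1 (BMultinom u0, BMultinom (ltnSn (mdeg u)))) /= ?add0m //.
rewrite big1 ?addr0 // => -[a b] /= /andP[/eqP ub ne].
rewrite (hh b) ?mulr0 // -uj ltn_neqAle -ltnS bmdeg andbT.
apply: contraNN ne => /eqP bu.
have a0 : mdeg a = 0%N by have := congr1 mdeg ub; rewrite mdegD; lia.
have {}a0 : (a : 'X_{1..n}) = 0%MM by apply/eqP; rewrite -mdeg_eq0 a0.
apply/eqP; congr (_, _); apply: val_inj => //=.
by rewrite -[LHS]add0m -a0 -ub.
Qed.

End Order.

HB.instance Definition _ (n : nat) (K : fieldType) (w : 'I_n -> nat) :=
  GRing.RMorphism.copy (@mpoly_curve n K w)
    (mmap (@mpolyC 1 K) (fun i => 'X_ord0 ^+ w i)).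

Section WeightComponents.
Variables (n : nat) (K : fieldType) (w : 'I_n -> nat).
Hypothesis w_gt0 : forall i, (0 < w i)%N.
Implicit Types (f g : mps n K) (p q : {mpoly K[n]}) (u v : 'X_{1..n}).

Definition wdeg u := (\sum_(i < n) u i * w i)%N.

Lemma wdegD u v : wdeg (u + v)%MM = (wdeg u + wdeg v)%N.
Proof.
rewrite /wdeg -big_split /=; apply: eq_bigr => i _.
by rewrite mnmDE mulnDl.
Qed.

Lemma wdeg1 i : wdeg U_(i)%MM = w i.
Proof.
rewrite /wdeg (bigD1 i) //= mnm1E eqxx mul1n big1 ?addn0 // => j ji.
by rewrite mnm1E eq_sym (negPf ji).
Qed.

Lemma wdeg0 : wdeg 0%MM = 0%N.
Proof. by rewrite /wdeg big1 // => i _; rewrite mnm0E. Qed.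

Lemma mdeg_le_wdeg u : (mdeg u <= wdeg u)%N.
Proof. by rewrite mdegE; apply: leq_sum => i _; rewrite leq_pmulr. Qed.

(** Weights being positive, a monomial of weight [k] has degree at most [k]: the bounded sum is the
    whole weighted component, and it is a polynomial. *)
Definition wcomp k f : {mpoly K[n]} := \sum_(u : 'X_{1..n < k.+1})
  (if wdeg u == k then mps_coef f u else 0) *: 'X_[u].

Lemma mcoeff_wcomp k f u :
  (wcomp k f)@_u = if wdeg u == k then mps_coef f u else 0.
Proof.
have [uk|ku] := ltnP (mdeg u) k.+1.
  exact: (mcoeff_mpoly (fun u => if wdeg u == k then mps_coef f u else 0)).
rewrite gtn_eqF ?(leq_trans ku) ?mdeg_le_wdeg // /wcomp raddf_sum big1 //= => v _.
rewrite mcoeffZ mcoeffX; have [vu|] := eqVneq (v : 'X_{1..n}) u; rewrite ?mulr0 //.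
by move: (bmdeg v); rewrite vu ltnNge ku.
Qed.

Lemma wcompD k f g : wcomp k (f + g) = wcomp k f + wcomp k g.
Proof.
by apply/mpolyP => u; rewrite mcoeffD !mcoeff_wcomp; case: eqP; rewrite ?addr0.
Qed.

Lemma wcomp0 k : wcomp k 0 = 0.
Proof. by apply/mpolyP => u; rewrite mcoeff_wcomp mcoeff0; case: eqP. Qed.

Lemma wcomp_inj f g : (forall k, wcomp k f = wcomp k g) -> f = g.
Proof.
move=> fg; apply: mpsP => u; have := mcoeff_wcomp (wdeg u) f u.
by rewrite fg mcoeff_wcomp eqxx.
Qed.

Lemma wcompM k f g :
  wcomp k (f * g) = \sum_(a < k.+1) wcomp a f * wcomp (k - a) g.
Proof.
apply/mpolyP => u; rewrite mcoeff_wcomp raddf_sum.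
rewrite [RHS](eq_bigr _ (fun a _ => mcoeffM _ _ _)) exchange_big /=; case: eqP => [uk|uk].
  apply: eq_bigr => -[x y] /= /eqP uxy.
  have wxy : wdeg u = (wdeg x + wdeg y)%N by rewrite -wdegD -uxy.
  have xk : (wdeg x < k.+1)%N by rewrite -uk wxy; lia.
  rewrite (bigD1 (Ordinal xk)) //= !mcoeff_wcomp eqxx.
  have -> : (k - wdeg x)%N = wdeg y by rewrite -uk wxy addKn.
  rewrite eqxx big1 ?addr0 // => a ax.
  rewrite mcoeff_wcomp; case: eqP => [xa|]; rewrite ?mul0r //.
  by case/negP: ax; apply/eqP/val_inj.
rewrite big1 // => -[x y] /= /eqP uxy; rewrite big1 // => a _.
rewrite !mcoeff_wcomp; case: eqP => [xa|]; rewrite ?mul0r //.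
case: eqP => [ya|]; rewrite ?mulr0 //.
by case: uk; have := congr1 wdeg uxy; rewrite wdegD xa ya; have := ltn_ord a; lia.
Qed.

Definition whomog k p := forall u, p@_u != 0 -> wdeg u = k.

Lemma whomogD k p q : whomog k p -> whomog k q -> whomog k (p + q).
Proof.
move=> hp hq u; rewrite mcoeffD; have [->|] := eqVneq p@_u 0; last by move/hp.
by rewrite add0r; apply: hq.
Qed.

Lemma whomog0 k : whomog k 0.
Proof. by move=> u; rewrite mcoeff0 eqxx. Qed.

Lemma whomogZ k a p : whomog k p -> whomog k (a *: p).
Proof.
by move=> hp u; rewrite mcoeffZ mulf_eq0 negb_or => /andP[_]; apply: hp.
Qed.

Lemma whomogN k p : whomog k p -> whomog k (- p).
Proof. by move=> hp; rewrite -scaleN1r; apply: whomogZ. Qed.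

Lemma whomogB k p q : whomog k p -> whomog k q -> whomog k (p - q).
Proof. by move=> hp hq; apply/whomogD/whomogN. Qed.

Lemma whomog_sum k (T : Type) (r : seq T) (P : pred T) (F : T -> {mpoly K[n]}) :
  (forall i, P i -> whomog k (F i)) -> whomog k (\sum_(i <- r | P i) F i).
Proof.
move=> hF; apply: (big_ind (whomog k)) => //; [exact: whomog0|exact: whomogD].
Qed.

Lemma whomogX u : whomog (wdeg u) 'X_[u].
Proof. by move=> v; rewrite mcoeffX; case: (eqVneq u v) => [->|]; rewrite ?eqxx. Qed.

Lemma whomog_msupp k p : whomog k p <-> forall u, u \in msupp p -> wdeg u = k.
Proof. by split=> hp u; have := hp u; rewrite mcoeff_msupp. Qed.

Lemma whomogM k l p q : whomog k p -> whomog l q -> whomog (k + l) (p * q).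
Proof.
move=> hp hq; apply/whomog_msupp => u /msuppM_le /allpairsP[[a b] /= [pa qb ->]].
by rewrite wdegD (proj1 (whomog_msupp _ _) hp) // (proj1 (whomog_msupp _ _) hq).
Qed.

Lemma whomog_expr k p i : whomog k p -> whomog (k * i) (p ^+ i).
Proof.
move=> hp; elim: i => [|i IH]; last by rewrite exprS mulnS; apply: whomogM.
by rewrite muln0 expr0 -mpolyX0 -wdeg0; apply: whomogX.
Qed.

Lemma whomog_prod (T : Type) (r : seq T) (P : pred T) (k : T -> nat)
    (F : T -> {mpoly K[n]}) : (forall i, P i -> whomog (k i) (F i)) ->
  whomog (\sum_(i <- r | P i) k i)%N (\prod_(i <- r | P i) F i).
Proof.
move=> hF; apply: (big_ind2 whomog) => //.
  by rewrite -mpolyX0 -wdeg0; apply: whomogX.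
by move=> *; apply: whomogM.
Qed.

Lemma wcomp_whomog k f : whomog k (wcomp k f).
Proof. by move=> u; rewrite mcoeff_wcomp; case: (eqVneq (wdeg u) k); rewrite ?eqxx. Qed.

Lemma whomog_wcomp k l p : whomog k p ->
  wcomp l (mps_of_mpoly p) = if l == k then p else 0.
Proof.
move=> hp; apply/mpolyP => u; rewrite mcoeff_wcomp /=.
have [pu|pu] := eqVneq p@_u 0; first by rewrite pu; do 2![case: ifP]; rewrite ?mcoeff0.
by rewrite (hp u pu) eq_sym; case: eqP; rewrite ?mcoeff0.
Qed.

Lemma sum_wcomp p :
  p = \sum_(k < (\max_(u <- msupp p) wdeg u).+1) wcomp k (mps_of_mpoly p).
Proof.
apply/mpolyP => u; rewrite raddf_sum /=.
have [pu|] := boolP (u \in msupp p); last first.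
  move=> /memN_msupp_eq0 pu; rewrite pu big1 // => k _.
  by rewrite mcoeff_wcomp /= pu if_same.
have uk : (wdeg u < (\max_(u <- msupp p) wdeg u).+1)%N.
  by rewrite ltnS; exact: (@leq_bigmax_seq _ _ xpredT wdeg).
rewrite (bigD1 (Ordinal uk)) //= mcoeff_wcomp eqxx big1 ?addr0 // => k ku.
rewrite mcoeff_wcomp; case: eqP => // uk'; case/negP: ku.
by apply/eqP/val_inj.
Qed.

(** On the curve every monomial of weight [k] becomes t^k, so the coefficient of t^k adds up the
    coefficients of the component. *)
Lemma wcomp_meval1 k f (e : 'X_{1..1}) : mdeg e = k ->
  (wcomp k f).@[fun=> 1] = mps_coef (mps_curve w f) e.
Proof.
move=> <- /=; rewrite /wcomp raddf_sum /= [RHS]big_mkcond /=.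
apply: eq_bigr => u _; rewrite mevalZ mevalX big1 ?mulr1 //.
by move=> i _; rewrite expr1n.
Qed.

Lemma mps_curve_eq0 f :
  mps_curve w f = 0 <-> forall k, (wcomp k f).@[fun=> 1] = 0.
Proof.
split=> [f0 k|f0]; last by apply: mpsP => e; rewrite -(wcomp_meval1 _ erefl) f0.
have e1 : mdeg (U_(ord0 : 'I_1) *+ k)%MM = k by rewrite mdegMn mdeg1 mul1n.
by rewrite (wcomp_meval1 f e1) f0.
Qed.

Section OrderFiltration.
Variables (l : nat) (theta : {rmorphism {mpoly K[n]} -> {mpoly K[l]}}).
Hypothesis theta1 : forall p, (theta p)@_0%MM = p.@[fun=> 1].

(** [theta] acts on polynomials only; applying it to each weighted component extends the order of
    vanishing to power series. *)
Definition ordF j : set (mps n K) :=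
  [set f | forall k, ord_ge j (theta (wcomp k f))].

Lemma ordF_filtration : filtration ordF.
Proof.
split=> [j|f k u //|i j f g fi gj k].
- have [o0 oD oM] := ord_ge_ideal l K j.
  split=> [k|f g fj gj k|a f fj k]; first by rewrite wcomp0 rmorph0.
    by rewrite wcompD rmorphD; apply: oD.
  rewrite wcompM rmorph_sum; apply: ideal_sum; first exact: ord_ge_ideal.
  by move=> i _; rewrite rmorphM; apply: oM.
- rewrite wcompM rmorph_sum; apply: ideal_sum; first exact: ord_ge_ideal.
  by move=> c _; rewrite rmorphM; apply: ord_geM.
Qed.

(* If [f] had smaller order, take a monomial of least order [j] in the least
   [theta (wcomp b f)], and the least component [a] of [s] with nonzero constant
   term: the product of the two survives in degree [j] of component [a + b]. *)
Lemma ordF_cancel j s f : mps_curve w s <> 0 -> ordF j (s * f) -> ordF j f.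
Proof.
move=> s0 sf; elim: j sf => [|j IH] sf; first by move=> k u.
have fj : ordF j f by apply: IH => k u uj; apply: sf; apply: ltnW.
have /existsNP[a0 a0P] : ~ forall k, (wcomp k s).@[fun=> 1] = 0.
  by move/mps_curve_eq0.
have exa : exists a, (wcomp a s).@[fun=> 1] != 0 by exists a0; apply/eqP.
case: (ex_minnP exa) => a sa amin.
move=> k u; rewrite ltnS leq_eqVlt => /orP[/eqP uj|]; last exact: fj.
apply/eqP/contraT => fu.
have exb : exists b, (theta (wcomp b f))@_u != 0 by exists k.
case: (ex_minnP exb) => b fb bmin.
have := sf (a + b)%N u; rewrite uj => /(_ (ltnSn j)).
rewrite wcompM rmorph_sum raddf_sum /=.
under eq_bigr => i _ do rewrite rmorphM (mcoeffM_lowest _ (fj _) uj) theta1.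
have ab : (a < (a + b).+1)%N by lia.
rewrite (bigD1 (Ordinal ab)) //= addKn big1 ?addr0.
  by move/eqP; rewrite mulf_eq0 (negPf sa) (negPf fb).
move=> i ia; have {}ia : i != a :> nat by apply: contraNneq ia => ia; apply/eqP/val_inj.
have [ai|] := ltnP i a.
  suff -> : (wcomp i s).@[fun=> 1] = 0 by rewrite mul0r.
  by apply/eqP/contraT => /amin; rewrite leqNgt ai.
move=> ai; suff -> : (theta (wcomp (a + b - i) f))@_u = 0 by rewrite mulr0.
by apply/eqP/contraT => /bmin; have := ltn_ord i; lia.
Qed.

Lemma ordF1 f : mps_curve w f = 0 -> ordF 1 f.
Proof.
move=> /mps_curve_eq0 f0 k u; rewrite ltnS leqn0 mdeg_eq0 => /eqP ->.
by rewrite theta1 f0.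
Qed.

(** Ordinary powers lie in [ordF] by [ordF1] and minimality; [ordF_cancel] then removes the
    multiplier outside the prime. *)
Lemma symbolic_ordF j : is_prime [set f : mps n K | mps_curve w f = 0] ->
  symbolic_power [set f : mps n K | mps_curve w f = 0] j `<=` ordF j.
Proof.
move=> Pp f /(symbolicP Pp)[s s0 sf]; apply: (ordF_cancel s0).
by apply: idexp_least sf; [exact: ordF_filtration | exact: ordF1].
Qed.

End OrderFiltration.

Lemma curve_prime : is_prime [set f : mps n K | mps_curve w f = 0].
Proof.
have [c1 cM] := mps_curve_multiplicative K w_gt0.
have cB := @mps_curve_additive n K w.
have c0 : mps_curve w (0 : mps n K) = 0 by rewrite -(subrr 0) cB subrr.
have cN f : mps_curve w (- f) = - mps_curve w f.
  by rewrite -sub0r cB c0 sub0r.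
split=> [|/eqP|f g /= /eqP]; last 1 first.
- by rewrite cM mulf_eq0 => /orP[/eqP|/eqP]; [left|right].
- split=> //= [f g f0 g0|f g g0]; last by rewrite cM g0 mulr0.
  by rewrite -[g]opprK cB cN f0 g0 oppr0 subr0.
- by rewrite c1 oner_eq0.
Qed.

Lemma mcurve_prime : is_prime [set p : {mpoly K[n]} | mpoly_curve w p = 0].
Proof.
split=> [|/eqP|f g /= /eqP]; last 1 first.
- by rewrite rmorphM mulf_eq0 => /orP[/eqP|/eqP]; [left|right].
- split=> //= [|f g f0 g0|f g g0]; first by rewrite rmorph0.
    by rewrite rmorphD /= f0 g0 addr0.
  by rewrite rmorphM /= g0 mulr0.
- by rewrite rmorph1 oner_eq0.
Qed.

Lemma mps_curve_mpoly_eq0 p :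
  mps_curve w (mps_of_mpoly p) = 0 <-> mpoly_curve w p = 0.
Proof.
rewrite mps_curve_mpoly //; split=> [|->]; last by rewrite rmorph0.
rewrite -[0]/(0 : mps 1 K) -(rmorph0 (@mps_of_mpoly 1 K)) => -[pq].
by apply/mpolyP => u; have := congr1 (fun h => h u) pq.
Qed.

Lemma mps_symbolic j p :
  symbolic_power [set p : {mpoly K[n]} | mpoly_curve w p = 0] j p ->
  symbolic_power [set f : mps n K | mps_curve w f = 0] j (mps_of_mpoly p).
Proof.
move=> /(symbolicP mcurve_prime)[s s0 sp]; apply/(symbolicP curve_prime).
exists (mps_of_mpoly s); first by move=> /mps_curve_mpoly_eq0.
rewrite -rmorphM.
pose F i := @mps_of_mpoly n K @^-1` idexp [set f : mps n K | mps_curve w f = 0] i.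
have HF : filtration F := preimage_filtration (@mps_of_mpoly n K) (idexp_filtration _).
apply: (idexp_least HF _ sp) => q q0; apply: idexp1.
exact/mps_curve_mpoly_eq0.
Qed.

End WeightComponents.

(** * Homogeneous generators *)

Section FiniteGeneration.
Variables (n : nat) (K : fieldType) (w : 'I_n -> nat).
Hypothesis w_gt0 : forall i, (0 < w i)%N.
Local Notation T := {mpoly K[n]}.
Implicit Types (I J : set T) (s : seq T).

Definition seqgen s : set T := idgen [set g | g \in s].

Definition fg_whomog I :=
  exists2 s, (forall g, g \in s -> exists k, whomog w k g) & I = seqgen s.

Lemma seqgenP s f : seqgen s f -> exists c, f = \sum_(i < size s) c i * s`_i.
Proof.
pose I : set T := [set f | exists c, f = \sum_(i < size s) c i * s`_i].
apply: (@idgen_sub _ _ I) => [|g gs].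
  split=> [|_ _ [c ->] [c' ->]|a _ [c ->]].
  - by exists (fun=> 0); rewrite big1 // => i _; rewrite mul0r.
  - exists (fun i => c i + c' i); rewrite -big_split.
    by apply: eq_bigr => i _; rewrite mulrDl.
  - exists (fun i => a * c i); rewrite mulr_sumr.
    by apply: eq_bigr => i _; rewrite mulrA.
have ig : (index g s < size s)%N by rewrite index_mem.
exists (fun i => (i == Ordinal ig)%:R).
rewrite (bigD1 (Ordinal ig)) //= eqxx mul1r nth_index // big1 ?addr0 // => i.
by move=> /negPf ->; rewrite mul0r.
Qed.

Lemma wcomp_sum (I : Type) (r : seq I) (P : pred I) (F : I -> mps n K) k :
  wcomp w k (\sum_(i <- r | P i) F i) = \sum_(i <- r | P i) wcomp w k (F i).
Proof. exact: (big_morph (wcomp w k) (wcompD w_gt0 k) (wcomp0 _ w_gt0 k)). Qed.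

Lemma wcomp_wcomp k (f : mps n K) : wcomp w k (mps_of_mpoly (wcomp w k f)) = wcomp w k f.
Proof.
by rewrite (whomog_wcomp w_gt0 k (@wcomp_whomog _ _ _ w_gt0 k f)) eqxx.
Qed.

(** Each component is a combination of the same finitely many homogeneous generators; the
    coefficients of one generator, over all weights, assemble into one power series. *)
Lemma idext_complete I f : fg_whomog I -> (forall k, I (wcomp w k f)) ->
  idext (@mps_of_mpoly n K) I f.
Proof.
move=> [s sh ->] fI.
have /choice[c cE] k := seqgenP (fI k).
have /choice[l lE] (i : 'I_(size s)) : exists k, whomog w k s`_i.
  by apply: sh; apply: mem_nth.
(* The part of [h i] of weight a comes from the expression of the component of weight a + [l i], the
   only one to which it contributes. *)
pose h i := Mps (fun u => (c (wdeg w u + l i)%N i)@_u).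
suff -> : f = \sum_(i < size s) h i * mps_of_mpoly s`_i.
  apply: ideal_sum => [|i _]; first exact: idgen_ideal.
  case: (idgen_ideal (@mps_of_mpoly n K @` seqgen s)) => _ _; apply.
  apply: sub_idgen; exists s`_i => //; apply: sub_idgen; exact: mem_nth.
apply: (wcomp_inj w_gt0) => k; rewrite -[LHS]wcomp_wcomp cE rmorph_sum !wcomp_sum.
apply: eq_bigr => i _; rewrite rmorphM !wcompM //; apply: eq_bigr => a _.
rewrite (whomog_wcomp w_gt0 _ (lE i)); case: eqP => [ka|]; rewrite ?mulr0 //.
congr (_ * _); apply/mpolyP => u; rewrite !mcoeff_wcomp //=.
by case: eqP => // ->; rewrite -ka subnKC // -ltnS.
Qed.

Lemma fg_whomog_fin (X : finType) (P : X -> Prop) (F : X -> T) :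
  (forall x, P x -> exists k, whomog w k (F x)) ->
  fg_whomog (idgen [set f | exists2 x, P x & f = F x]).
Proof.
move=> FP; exists [seq F x | x <- enum X & `[< P x >]].
  by move=> g /mapP[x]; rewrite mem_filter => /andP[/asboolP /FP Fx _] ->; apply: Fx.
congr idgen; apply/seteqP; split=> [_ [x Px ->]|_ /mapP[x + ->]] /=.
  by apply/mapP; exists x; rewrite // mem_filter mem_enum andbT; apply/asboolP.
by rewrite mem_filter => /andP[/asboolP ? _]; exists x.
Qed.

Lemma fg_whomog_setT : fg_whomog setT.
Proof.
exists [:: 1].
  move=> g; rewrite inE => /eqP ->; exists 0%N; rewrite -(wdeg0 w) -mpolyX0.
  exact: whomogX.
apply/seteqP; split=> // f _; rewrite -[f]mulr1.
case: (idgen_ideal [set g | g \in [:: (1 : T)]]) => _ _; apply.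
by apply: sub_idgen; rewrite /= inE.
Qed.

Lemma fg_whomog_idmul I J :
  fg_whomog I -> fg_whomog J -> fg_whomog (idmul I J).
Proof.
move=> [s sh ->] [t th ->]; exists [seq x * y | x <- s, y <- t].
  move=> _ /allpairsP[[x y] /= [/sh[k hx] /th[l hy] ->]].
  by exists (k + l)%N; apply: whomogM.
have st_id : is_ideal (seqgen [seq x * y | x <- s, y <- t]) by exact: idgen_ideal.
have [st0 stD stM] := st_id.
apply/seteqP; split.
  apply: idmul_sub => // f g fs gt.
  pose Q := [set x | seqgen [seq x * y | x <- s, y <- t] (x * g)].
  apply: (@idgen_sub _ _ Q _ _ f fs) => [|x xs].
    split=> [|a b Qa Qb|a b Qb]; rewrite /Q /= ?mul0r ?mulrDl -?mulrA //.
      exact: stD.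
    exact: stM.
  pose Q' := [set z | seqgen [seq x * y | x <- s, y <- t] (x * z)].
  apply: (@idgen_sub _ _ Q' _ _ g gt) => [|y yt].
    split=> [|a b Qa Qb|a b Qb]; rewrite /Q' /= ?mulr0 ?mulrDr 1?mulrCA //.
      exact: stD.
    exact: stM.
  by apply: sub_idgen; apply/allpairsP; exists (x, y).
apply: idgen_sub; first exact: idgen_ideal.
move=> _ /allpairsP[[x y] /= [xs yt ->]].
by apply: idmulM; apply: sub_idgen.
Qed.

(** Exponents of weighted sum [k] are at most [k], so only finitely many products of ideals
    occur. *)
Lemma fg_whomog_weighted_sum r (X : nat -> set T) k :
  (forall i, fg_whomog (X i)) -> fg_whomog (weighted_sum r X k).
Proof.
move=> Xfg.
pose Y (a : 'I_r -> nat) := \big[@idmul T/setT]_(i < r) idexp (X i.+1) (a i).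
have Yfg a : fg_whomog (Y a).
  apply: (big_ind fg_whomog); first exact: fg_whomog_setT.
    exact: fg_whomog_idmul.
  move=> i _; elim: (a i) => [|j IH]; first exact: fg_whomog_setT.
  exact: fg_whomog_idmul.
have /choice[s sP] (a : {ffun 'I_r -> 'I_k.+1}) : exists s,
    (forall g, g \in s -> exists k, whomog w k g) /\ Y (fun i => val (a i)) = seqgen s.
  by have [s ? ?] := Yfg (fun i => val (a i)); exists s.
pose wk (a : {ffun 'I_r -> 'I_k.+1}) := (\sum_(i < r) i.+1 * a i == k)%N.
exists (flatten [seq s a | a <- enum wk]).
  by move=> g /flatten_mapP[a _ ga]; apply: (proj1 (sP a)).
apply/seteqP; split; apply: idgen_sub; try exact: idgen_ideal.
  move=> f [a [ak]].
  have ab i : (a i < k.+1)%N.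
    by rewrite ltnS -ak (bigD1 i) //= mulSn -addnA leq_addr.
  pose b := [ffun i => Ordinal (ab i)].
  have -> : a = fun i => val (b i) by apply/funext => i; rewrite ffunE.
  rewrite -/(Y _) (proj2 (sP b)); apply: idgen_sub; first exact: idgen_ideal.
  move=> g gs; apply: sub_idgen; apply/flatten_mapP; exists b => //.
  rewrite mem_enum; apply/eqP; rewrite -[RHS]ak.
  by apply: eq_bigr => i _; rewrite ffunE.
move=> g /flatten_mapP[a]; rewrite mem_enum => /eqP ak ga.
apply: sub_idgen; exists (fun i : 'I_r => val (a i)); split=> //.
by rewrite -/(Y _) (proj2 (sP a)); apply: sub_idgen.
Qed.

End FiniteGeneration.

(** * The monomial ideals of T' *)

Section MonomialFiltration.
Variables (n : nat) (K : fieldType).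

(** With [a = 0] the second condition makes each [L b] stable under multiplication by monomials, so
    the polynomials supported on it form an ideal. *)
Definition mon_filtration (L : nat -> 'X_{1..n} -> Prop) :=
  (forall u, L 0%N u) /\
  (forall a b u v, L a u -> L b v -> L (a + b)%N (u + v)%MM).

Lemma mon_filtrationP (L : nat -> 'X_{1..n} -> Prop) : mon_filtration L ->
  filtration (fun a => [set f : {mpoly K[n]} | forall u, u \in msupp f -> L a u]).
Proof.
move=> [L0 LD]; split=> [a|f u _|a b f g fa gb u] /=; last 2 first.
- exact: L0.
- by move=> /msuppM_le /allpairsP[[v w] /= [vf wg ->]]; apply: LD; auto.
split=> [u|f g fa ga u|h f fa u]; first by rewrite msupp0.
  by move=> /msuppD_le; rewrite mem_cat => /orP[]; auto.
move=> /msuppM_le /allpairsP[[v w] /= [vf wg ->]].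
by rewrite -[a]add0n; apply: LD; auto.
Qed.

Lemma mnm_gt0_ex (u : 'X_{1..n}) : (0 < mdeg u)%N -> exists i, (0 < u i)%N.
Proof.
rewrite lt0n => u0; apply: contrapT => /forallNP u_0; case/negP: u0.
rewrite mdeg_eq0; apply/eqP/mnmP => i; rewrite mnm0E; apply/eqP.
by rewrite -leqn0 leqNgt; apply/negP.
Qed.

Lemma mnm_subU (u : 'X_{1..n}) i : (0 < u i)%N -> u = (U_(i) + (u - U_(i)))%MM.
Proof.
move=> ui; rewrite addmC submK //; apply/mnm_lepP => j.
by rewrite mnm1E; case: eqP => [<-|].
Qed.

End MonomialFiltration.

(** * Greedy factorization of monomials and its inverse *)

Section Greedy.
Variables (e : nat) (K : fieldType).
Local Notation mon := 'X_{1..e.+1}.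
Implicit Types (a u M Z : mon).

Definition supp_ge (k : nat) u := forall i : 'I_e.+1, (i < k)%N -> u i = 0%N.

Lemma JT'_mon i k u : (i <= k.+1)%N -> supp_ge k u -> (i < mdeg u)%N ->
  @JT' K e.+2 i 'X_[u].
Proof.
move=> ik; rewrite /JT'; set G := idgen _; elim: i.+1 u => [|s IH] //= u uk us.
have [j uj] : exists j, (0 < u j)%N by apply: mnm_gt0_ex; lia.
have kj : (k <= j)%N by rewrite leqNgt; apply/negP => /uk uj0; rewrite uj0 in uj.
rewrite (mnm_subU uj) mpolyXD; apply: idmulM.
  by apply: sub_idgen; exists j => //; apply: (leq_trans ik); rewrite ltnS.
apply: IH => [l lk|]; first by rewrite mnmBE uk.
by move: us; rewrite {1}(mnm_subU uj) mdegD mdeg1.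
Qed.

Local Notation I n := (IT' K e.+2 n).

Lemma IT'_filtration : filtration (fun n => I n).
Proof. exact: weighted_sum_filtration. Qed.

Lemma IT'_mon i k u : (i <= k.+1)%N -> (k < e.+1)%N -> supp_ge k u ->
  (i < mdeg u)%N -> I i 'X_[u].
Proof.
case: i => [|i] ik ke uk ui.
  by case: IT'_filtration => _ + _; apply.
have ie : (i < e.+2.-1)%N by rewrite /=; lia.
exact: (@weighted_sum_gen _ e.+1 (@JT' K e.+2) i ie _ (JT'_mon ik uk ui)).
Qed.

(* State of the greedy process that writes a monomial, its variables being read
   in increasing order, as a product of blocks; a block starting with [x_j] has
   at most [j] variables and its weight is its number of variables minus [1].
   Here the current block has [c] free places, [v] is the total weight, and
   variables read later have an index at least [k]. *)
Definition greedy_state k c v M := forall Z n, supp_ge k Z -> (mdeg Z <= c)%N ->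
  (n <= v + mdeg Z)%N -> I n 'X_[M + Z].

Lemma greedy_state0 : greedy_state 0 0 0 0%MM.
Proof.
move=> Z n _; rewrite leqn0 => /eqP -> /=; rewrite leqn0 => /eqP ->.
by case: IT'_filtration => _ + _; apply.
Qed.

Lemma greedy_stateS k c v M : greedy_state k c v M -> greedy_state k.+1 c v M.
Proof. by move=> MP Z n Zk; apply: MP => i ik; apply: Zk; apply: ltnW. Qed.

Lemma supp_geD k u v : supp_ge k u -> supp_ge k v -> supp_ge k (u + v)%MM.
Proof. by move=> uk vk i ik; rewrite mnmDE uk // vk. Qed.

Lemma supp_geU (i : 'I_e.+1) : supp_ge i U_(i)%MM.
Proof. by move=> j ji; rewrite mnm1E; case: eqP ji => // ->; rewrite ltnn. Qed.

(** Division of [c + i.+1] by [i.+2] encodes both moves: from [c = 0] a block opens, with [i.+1]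
    places left and no gain; from [c > 0] one place is filled, and the quotient 1 is the weight
    gained. *)
Lemma greedy_step (i : 'I_e.+1) c v M : (c < i.+2)%N -> greedy_state i c v M ->
  greedy_state i ((c + i.+1) %% i.+2) (v + (c + i.+1) %/ i.+2) (M + U_(i))%MM.
Proof.
move=> ci MP Z n Zi; have [c0|c_gt0] := posnP c.
  rewrite c0 add0n modn_small // divn_small // addn0 -addmA => Zc nv.
  have [_ _ IM] := IT'_filtration.
  (* With s the minimum of [n] and [mdeg Z], the old monomial lies in [I (n - s)] and the new block,
     of degree [mdeg Z + 1], in [I s]. *)
  rewrite -(subnK (geq_minl n (mdeg Z))) mpolyXD -[M]addm0; apply: IM.
    by apply: MP => [j _||]; rewrite ?mnm0E ?mdeg0 ?addn0 //; move: nv; rewrite -?leq_subLR /minn; case: ltnP; lia.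
  apply: (@IT'_mon _ i) => //; first by lia.
    by apply: supp_geD => //; apply: supp_geU.
  by rewrite mdegD mdeg1; lia.
have -> : (c + i.+1 = c.-1 + i.+2)%N by lia.
rewrite modnDr divnDr // divnn /= modn_small ?divn_small; try lia.
rewrite -addmA => Zc nv; apply: MP; rewrite ?mdegD ?mdeg1; try lia.
by apply: supp_geD => //; apply: supp_geU.
Qed.

Lemma greedy_steps (i : 'I_e.+1) c v M k : (c < i.+2)%N -> greedy_state i c v M ->
  greedy_state i ((c + k * i.+1) %% i.+2) (v + (c + k * i.+1) %/ i.+2)
    (M + U_(i) *+ k)%MM.
Proof.
move=> ci MP; elim: k => [|k IH].
  by rewrite mul0n addn0 modn_small // divn_small // addn0 mulm0n addm0.
have lt := ltn_pmod (c + k * i.+1) (ltn0Sn i.+1).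
have := greedy_step lt IH.
have -> : (c + k.+1 * i.+1 = (c + k * i.+1) %/ i.+2 * i.+2
            + ((c + k * i.+1) %% i.+2 + i.+1))%N.
  by rewrite addnA -divn_eq mulSn; lia.
by rewrite modnMDl divnMDl // addnA mulmSr addmA.
Qed.

(* [st u k] is the number of free places before the variable of index [k] is
   read, and [gain u k] the weight gained while reading it. *)
Fixpoint st u (k : nat) : nat := if k is k'.+1 then
  (st u k' + u (inord k') * k'.+1) %% k'.+2 else 0.

Definition gain u (k : nat) : nat := (st u k + u (inord k) * k.+1) %/ k.+2.

Lemma st_lt u k : (st u k < k.+1)%N.
Proof. by case: k => // k; rewrite ltn_pmod. Qed.

Definition mtrunc (k : nat) u : mon :=
  [multinom (if (i < k)%N then u i else 0%N) | i < e.+1].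

Lemma greedy_stateP u k : (k <= e.+1)%N ->
  greedy_state k (st u k) (\sum_(i < k) gain u i)
    (mtrunc k u).
Proof.
elim: k => [|k IH] ke.
  rewrite big_ord0 (_ : mtrunc 0 u = 0%MM); first exact: greedy_state0.
  by apply/mnmP => i; rewrite !mnmE.
have ik : (inord k : 'I_e.+1) = k :> nat by apply: inordK.
have := IH (ltnW ke); rewrite -{1}ik => /greedy_steps.
rewrite ik => /(_ (u (inord k)) (ltnW (st_lt u k))) => /greedy_stateS.
rewrite big_ord_recr /= -/(gain u k).
congr (greedy_state _ _ _ _); apply/mnmP => i; rewrite mnmDE !mnmE mulmnE mnm1E.
have [ki|ki] := eqVneq (inord k) i.
  by rewrite -ki ik ltnn ltnSn mul1n.
rewrite ltnS [in RHS]leq_eqVlt; have -> : (i == k :> nat) = false.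
  by apply: contraNF ki => /eqP <-; rewrite inord_val.
by rewrite mul0n addn0.
Qed.

Lemma gain_mem u n : (n <= \sum_(i < e.+1) gain u i)%N -> I n 'X_[u].
Proof.
move=> nu; have := @greedy_stateP u _ (leqnn e.+1).
rewrite (_ : mtrunc _ u = u); last first.
  by apply/mnmP => i; rewrite mnmE ltn_ord.
move=> /(_ 0%MM n); rewrite addm0 mdeg0 addn0; apply=> // i _.
by rewrite mnm0E.
Qed.

(* The inverse of [u |-> (st u e.+1, gain u)]: [cst c v k] recovers the state
   [k] stages before the end. *)
Fixpoint cst (c : nat) (v : mon) (k : nat) : nat := if k is k'.+1 then
  (cst c v k' + v (inord (e - k'))) %% (e - k').+1 else c.

Definition std_mon (c : nat) (v : mon) : mon :=
  [multinom (v i + (cst c v (e - i) + v i) %/ i.+1)%N | i < e.+1].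

Lemma std_monK u :
  std_mon (st u e.+1) [multinom gain u i | i < e.+1] = u.
Proof.
set v := [multinom _ | _ < _].
have vE k : (k < e.+1)%N -> v (inord k) = gain u k.
  by move=> ke; rewrite mnmE inordK.
(* The division by [k.+2] defining the next state, rearranged as a division by [k.+1] whose
   remainder is the previous state: this makes the process reversible. *)
have key k : (k < e.+1)%N -> (st u k.+1 + gain u k
     = (u (inord k) - gain u k) * k.+1 + st u k)%N /\ (gain u k <= u (inord k))%N.
  move=> ke; have E := divn_eq (st u k + u (inord k) * k.+1) k.+2.
  have gu : (gain u k <= u (inord k))%N.
    rewrite -ltnS ltn_divLR //; have := st_lt u k; lia.
  split=> //; move: E; rewrite /= -/(gain u k); nia.
have cstE k : (k <= e.+1)%N -> cst (st u e.+1) v k = st u (e.+1 - k).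
  elim: k => [|k IH] ke; first by rewrite subn0.
  have ek : (e.+1 - k = (e - k).+1)%N by lia.
  rewrite [LHS]/= IH ?(ltnW ke) // vE ?ek; last by lia.
  have ek' : (e - k < e.+1)%N by lia.
  have [-> _] := key (e - k)%N ek'.
  by rewrite modnMDl modn_small ?st_lt // subSS.
apply/mnmP => i; rewrite mnmE -{1 3}[i]inord_val vE // cstE; last by lia.
have [E gu] := key i (ltn_ord i).
have -> : (e.+1 - (e - i) = i.+1)%N by have := ltn_ord i; lia.
by rewrite E divnMDl // divn_small ?st_lt // addn0 subnKC // inord_val.
Qed.

(** A total gain of at least [n] puts the monomial in [I n]; otherwise the gains form a monomial [v]
    of degree below [n], and with the final state they determine [u]. *)
Lemma std_mon_or u n : I n 'X_[u] \/
  exists c v, [/\ (c < e.+2)%N, (mdeg v < n)%N & u = std_mon c v].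
Proof.
have [nu|un] := leqP n (\sum_(i < e.+1) gain u i); first by left; apply: gain_mem.
right; exists (st u e.+1), [multinom gain u i | i < e.+1].
split; [exact: st_lt | | by rewrite std_monK].
by rewrite mdegE; under eq_bigr => i _ do rewrite mnmE.
Qed.

End Greedy.

(** * Reduction modulo x_1 *)

HB.instance Definition _ (K : fieldType) (d : nat) :=
  GRing.RMorphism.copy (@modx1 K d) (mmap (@mpolyC d.-1 K)
       (fun i : 'I_d => if i == 0 :> nat then 0 else mvar d.-1 K i.-1)).

Lemma mvarE (n : nat) (K : fieldType) (i : 'I_n) : mvar n K i = 'X_i.
Proof. by rewrite /mvar valK. Qed.

Section Reduction.
Variables (e m : nat) (K : fieldType).
Local Notation mon := 'X_{1..e.+1}.
Local Notation T := {mpoly K[e.+2]}.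
Local Notation T' := {mpoly K[e.+1]}.
Local Notation wd := (wdeg (@curve_weight e.+2 m)).
Local Notation hom := (whomog (@curve_weight e.+2 m)).
Local Notation modx1 := (@modx1 K e.+2 : T -> T').
Implicit Types (u v : mon) (p q : T).

Lemma curve_weight_gt0 (i : 'I_e.+2) : (0 < curve_weight m i)%N.
Proof. by []. Qed.

Definition emb u : 'X_{1..e.+2} :=
  [multinom (if unlift ord0 i is Some j then u j else 0%N) | i < e.+2].

Definition rest (v : 'X_{1..e.+2}) : mon := [multinom v (lift ord0 i) | i < e.+1].

Lemma emb0 u : emb u ord0 = 0%N.
Proof. by rewrite mnmE unlift_none. Qed.

Lemma emb_lift u i : emb u (lift ord0 i) = u i.
Proof. by rewrite mnmE liftK. Qed.

Lemma embK u : rest (emb u) = u.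
Proof. by apply/mnmP => i; rewrite mnmE emb_lift. Qed.

Lemma emb_rest (v : 'X_{1..e.+2}) : v ord0 = 0%N -> emb (rest v) = v.
Proof.
move=> v0; apply/mnmP => i; case: (unliftP ord0 i) => [j|] ->.
  by rewrite emb_lift mnmE.
by rewrite emb0.
Qed.

Lemma emb_inj : injective emb.
Proof. exact: can_inj embK. Qed.

Lemma modx1X (v : 'X_{1..e.+2}) :
  modx1 'X_[v] = if v ord0 == 0%N then 'X_[rest v] else 0.
Proof.
rewrite /Defs.modx1 mmapX /mmap1 big_ord_recl eqxx.
have [->|v0] := eqVneq (v ord0) 0%N; last by rewrite expr0n (negPf v0) mul0r.
rewrite expr0 mul1r [RHS]mpolyXE_id; apply: eq_bigr => i _.
by rewrite (mvarE K i) mnmE.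
Qed.

Lemma mcoeff_modx1 p u : (modx1 p)@_u = p@_(emb u).
Proof.
elim/mpolyind: p => [|c v p _ _ IH]; first by rewrite rmorph0 !mcoeff0.
rewrite rmorphD !mcoeffD IH -mul_mpolyC rmorphM /=; congr (_ + _).
rewrite modx1X {1}/Defs.modx1 mmapC !mcoeffCM mcoeffX; congr (_ * _).
have [v0|v0] := eqVneq (v ord0) 0%N.
  by rewrite mcoeffX -(inj_eq emb_inj) emb_rest.
by rewrite mcoeff0; case: (eqVneq v (emb u)) v0 => [->|//]; rewrite emb0.
Qed.

(** Within one degree [mon_gt] reverses the order [<] on monomials, so [u] is the leading monomial
    of the form [q]. *)
Definition least_mon (q : T') u :=
  q@_u != 0 /\ forall v, q@_v != 0 -> mdeg v = mdeg u /\ (u <= v)%O.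

Definition lead E u := (exists w, hom w E) /\ least_mon (modx1 E) u.

Lemma lead_hom E u : lead E u -> hom (wd (emb u)) E.
Proof.
by move=> [[w Ew] [Eu _]]; rewrite (Ew (emb u)) // -mcoeff_modx1.
Qed.

Lemma least_monM (q q' : T') u v :
  least_mon q u -> least_mon q' v -> least_mon (q * q') (u + v)%MM.
Proof.
move=> [qu qm] [qv qm']; split.
  rewrite mcoeffM.
  have ub : (mdeg u < (mdeg (u + v)%MM).+1)%N by rewrite mdegD ltnS leq_addr.
  have vb : (mdeg v < (mdeg (u + v)%MM).+1)%N by rewrite mdegD ltnS leq_addl.
  rewrite (bigD1 (BMultinom ub, BMultinom vb)) //= big1 ?addr0.
    by rewrite mulf_neq0.
  move=> -[a b] /= /andP[/eqP uv ab].
  have [->|qa] := eqVneq q@_a 0; first by rewrite mul0r.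
  have [->|qb] := eqVneq q'@_b 0; first by rewrite mulr0.
  have [_ ua] := qm _ qa; have [_ vb'] := qm' _ qb.
  have ua' : u = a.
    move: ua; rewrite le_eqVlt => /orP[/eqP //|ua].
    by have := ltmc_le_add ua vb'; rewrite -uv ltxx.
  have vb2 : v = b by apply: (@addmI _ u); rewrite {2}ua'.
  by case/eqP: ab; congr (_, _); apply: val_inj.
move=> x; rewrite -mcoeff_msupp => /msuppM_le /allpairsP[[a b] /= [qa qb ->]].
rewrite !mcoeff_msupp in qa qb.
have [da ua] := qm _ qa; have [db vb] := qm' _ qb.
by rewrite !mdegD da db; split=> //; apply: lem_add.
Qed.

Lemma leadM E F u v : lead E u -> lead F v -> lead (E * F) (u + v)%MM.
Proof.
move=> [[w Ew] Eu] [[w' Fw] Fv]; split.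
  by exists (w + w')%N; apply: whomogM.
by rewrite rmorphM; apply: least_monM.
Qed.

Definition leadset n u := exists2 E, calI K e.+2 m n E & lead E u.

Lemma calI_filtration : filtration (fun n => calI K e.+2 m n).
Proof. exact: weighted_sum_filtration. Qed.

Lemma leadset_filtration : mon_filtration leadset.
Proof.
have [_ I0 IM] := calI_filtration.
split=> [u|a b u v [E EI Eu] [F FI Fv]]; last first.
  by exists (E * F); [apply: IM | apply: leadM].
exists 'X_[emb u] => //; split; first by exists (wd (emb u)); apply: whomogX.
rewrite modx1X emb0 eqxx embK; split=> [|v]; rewrite mcoeffX ?eqxx ?oner_eq0 //.
by case: (eqVneq u v) => [->|]; rewrite ?eqxx.
Qed.

End Reduction.

(** * The antidiagonal term of a Hankel minor *)

Section Antidiagonal.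
Variables (e i : nat) (tau : 'I_i.+1 -> nat).
Hypothesis tau_mono : forall s s' : 'I_i.+1, (s < s')%N -> (tau s < tau s')%N.
Implicit Type sg : 'S_i.+1.

Definition rev_perm : 'S_i.+1 := perm (@rev_ord_inj i.+1).

(** Modulo x_1 only the entries whose row and column indices have a sum strictly between [0] and
    [e.+2] survive. *)
Definition in_range sg :=
  forall k : 'I_i.+1, (0 < k + tau (sg k) < e.+2)%N.

(** An entry with index sum [h] is x_(h+1), which is numbered [h.-1] in T'. *)
Definition hvar h : 'X_{1..e.+1} := U_(inord h.-1)%MM.

Definition term_mon sg := (\sum_(k < i.+1) hvar (k + tau (sg k)))%MM.

Lemma mdeg_term_mon sg : mdeg (term_mon sg) = i.+1.
Proof.
rewrite /term_mon mdeg_sum; under eq_bigr => k _ do rewrite mdeg1.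
by rewrite sum1_card card_ord.
Qed.

(** At the first [k] where [sg] differs from the reversal, the larger values are used up, so [sg k]
    is less than [rev_ord k], a value taken later. *)
Lemma ascent_ex sg : sg != rev_perm ->
  exists k k' : 'I_i.+1, (k < k')%N && (sg k < sg k')%N.
Proof.
move=> sgrev.
have exk : exists k : nat, [exists j : 'I_i.+1, (j == k :> nat) && (sg j != rev_ord j)].
  have [j jP] : exists j, sg j != rev_ord j.
    apply: contrapT => /forallNP jP; case/eqP: sgrev; apply/permP => j.
    by rewrite permE; apply/eqP/contraT => /jP.
  by exists j; apply/existsP; exists j; rewrite eqxx.
case: (ex_minnP exk) => _ /existsP[k /andP[/eqP <- kP]] kmin.
have small (j : 'I_i.+1) : (j < k)%N -> sg j = rev_ord j.
  move=> jk; apply/eqP/contraT => jP.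
  suff : (k <= j)%N by rewrite leqNgt jk.
  by apply: kmin; apply/existsP; exists j; rewrite eqxx.
pose k' := (sg^-1)%g (rev_ord k); have sgk' : sg k' = rev_ord k by rewrite permKV.
exists k, k'; rewrite sgk'; apply/andP; split.
  rewrite ltn_neqAle; apply/andP; split.
    by apply: contraNneq kP => /val_inj kk'; rewrite {1}kk' sgk'.
  rewrite leqNgt; apply/negP => k'k.
  have := small _ k'k; rewrite sgk' => /rev_ord_inj kk'.
  by rewrite kk' ltnn in k'k.
rewrite ltn_neqAle kP /= leqNgt; apply/negP => rk.
pose j := rev_ord (sg k); have sgj : sg k = rev_ord j by rewrite rev_ordK.
have jk : (j < k)%N.
  by move: rk => /=; have := ltn_ord (sg k); have := ltn_ord k; lia.
have := small _ jk; rewrite -sgj => /perm_inj jk'.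
by rewrite jk' ltnn in jk.
Qed.

(** The first exponent that differs is that of [hvar a], the variable of least index, absent from
    the left side. *)
Lemma hvar_swap a b c d : (0 < a)%N -> (a < b)%N -> (a < c)%N -> (d < e.+2)%N ->
  (b < d)%N -> (c < d)%N -> ((hvar b + hvar c)%MM < (hvar a + hvar d)%MM)%O.
Proof.
move=> a0 ab ac de bd cd; apply/ltmcP; first by rewrite !mdegD !mdeg1.
have neq h j : (j.+1 < h)%N -> (h < e.+2)%N -> hvar h (inord j : 'I_e.+1) = 0%N.
  move=> jh he; rewrite mnm1E; case: eqP => // /(congr1 val).
  by rewrite /= !inordK; lia.
exists (inord a.-1) => [j|].
  rewrite inordK => [ja|]; last by lia.
  rewrite !mnmDE -[j]inord_val !neq ?addn0; try lia.
by rewrite !mnmDE (neq b) ?(neq c) ?(neq d) ?mnm1E ?eqxx; try lia.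
Qed.

(** Exchanging the values at an ascent replaces two index sums by two strictly between them. This
    stays in range, lowers the term by [hvar_swap] and decreases the sum of [k * sg k]; it ends at
    the reversal. *)
Lemma term_mon_rev_lt sg : in_range sg -> sg != rev_perm ->
  (term_mon rev_perm < term_mon sg)%O.
Proof.
have [n] := ubnP (\sum_(k < i.+1) k * sg k)%N; elim: n sg => // n IH sg sgn sgr sgrev.
have [k [k' /andP[kk' sgkk']]] := ascent_ex sgrev.
pose sg' : 'S_i.+1 := (tperm k k' * sg)%g.
have sg'k : sg' k = sg k' by rewrite permM tpermL.
have sg'k' : sg' k' = sg k by rewrite permM tpermR.
have k'k : k' != k by apply: contraTneq kk' => ->; rewrite ltnn.
have sg'j j : (j != k) && (j != k') -> sg' j = sg j.
  by move=> /andP[jk jk']; rewrite permM tpermD // eq_sym.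
have ta := tau_mono sgkk'.
have rk := sgr k; have rk' := sgr k'.
have lt : (term_mon sg' < term_mon sg)%O.
  rewrite /term_mon (bigD1 k) //= (bigD1 k') //= [in ltRHS](bigD1 k) //=.
  rewrite [in ltRHS](bigD1 k') //= !addmA sg'k sg'k'.
  under eq_bigr => j jP do rewrite sg'j //.
  by rewrite ltmc_add2l; apply: hvar_swap; lia.
have sgr' : in_range sg'.
  move=> j; have [->|jk] := eqVneq j k; first by rewrite sg'k; lia.
  have [->|jk'] := eqVneq j k'; first by rewrite sg'k'; lia.
  by rewrite sg'j ?jk ?jk' //; apply: sgr.
have [<- //|sgrev'] := eqVneq sg' rev_perm.
apply: lt_trans lt; apply: IH => //; rewrite ltnS in sgn; apply: leq_trans sgn.
rewrite (bigD1 k) //= (bigD1 k') //= [in X in (_ < X)%N](bigD1 k) //=.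
rewrite [in X in (_ < X)%N](bigD1 k') //= !addnA sg'k sg'k'.
under eq_bigr => j jP do rewrite sg'j //.
by rewrite ltn_add2r; nia.
Qed.

End Antidiagonal.

(** * Minors realizing a given leading monomial *)

Section Blocks.
Variables (e m : nat) (K : fieldType).
Local Notation mon := 'X_{1..e.+1}.
Local Notation X := (Xmat K e.+2 m).
Local Notation hom := (whomog (@curve_weight e.+2 m)).
Local Notation modx1 := (@modx1 K e.+2).

Lemma XmatE (r c : 'I_e.+2) : X r c = if (r + c < e.+2)%N then 'X_(inord (r + c))
  else 'X_ord0 ^+ m * 'X_(inord (r + c - e.+2)).
Proof.
rewrite mxE; case: ltnP => [rc|rc]; first by rewrite -(mvarE K (inord _)) inordK.
rewrite -(mvarE K (inord _)) -(mvarE K ord0) inordK //.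
by have := ltn_ord r; have := ltn_ord c; lia.
Qed.

(** The factor x_1^m, of weight [e.+2 * m], makes up for the index dropping by [e.+2]. *)
Lemma Xmat_hom (r c : 'I_e.+2) : hom (e.+2 + (r + c) * m)%N (X r c).
Proof.
have hX (i : 'I_e.+2) : hom (curve_weight m i) ('X_i : {mpoly K[e.+2]}).
  by rewrite -(wdeg1 (@curve_weight e.+2 m)); apply: whomogX.
rewrite XmatE; case: ltnP => rc.
  by have := hX (inord (r + c)); rewrite /curve_weight inordK.
have := whomogM (whomog_expr (hX ord0) (i := m)) (hX (inord (r + c - e.+2))).
rewrite /curve_weight inordK; last by have := ltn_ord r; have := ltn_ord c; lia.
by congr whomog; rewrite /= mulnBl; nia.
Qed.

(** The weight of an entry is a row part plus a column part, so all terms of the determinant have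
    equal weight. *)
Lemma det_hom k (r c : 'I_k -> 'I_e.+2) :
  exists w, hom w (\det (mxsub r c X)).
Proof.
exists (\sum_(i < k) (e.+2 + r i * m) + \sum_(i < k) c i * m)%N.
apply: whomog_sum => s _; rewrite mulr_sign.
suff hs : hom (\sum_(i < k) (e.+2 + r i * m) + \sum_(i < k) c i * m)%N
    (\prod_i mxsub r c X i (s i)) by case: ifP => // _; apply: whomogN.
rewrite [X in (_ + X)%N](reindex_inj (@perm_inj _ s)) -big_split /=.
apply: whomog_prod => i _; rewrite mxE -addnA -mulnDl; exact: Xmat_hom.
Qed.

Hypothesis m_gt0 : (0 < m)%N.

Lemma modx1_Xmat (r c : 'I_e.+2) : modx1 (X r c) =
  if (0 < r + c < e.+2)%N then 'X_[hvar e (r + c)] else 0.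
Proof.
rewrite XmatE; case: ltnP => rc; last first.
  rewrite andbF rmorphM rmorphXn /= (modx1X K U_(ord0)) mnm1E eqxx /=.
  by rewrite expr0n gtn_eqF // mul0r.
have E0 : (inord (r + c) == ord0 :> 'I_e.+2) = (r + c == 0)%N.
  by rewrite -(inj_eq val_inj) /= inordK.
rewrite andbT (modx1X K U_(inord (r + c))) mnm1E E0 eqb0 -lt0n.
case: posnP => // rc0; congr 'X_[_]; apply/mnmP => j; rewrite mnmE !mnm1E.
rewrite -!(inj_eq val_inj) /= !inordK; try lia.
by congr (nat_of_bool _); rewrite /bump /=; lia.
Qed.

Variables (i : nat) (t : seq 'I_e.+1).
Hypothesis (i_gt0 : (0 < i)%N) (size_t : size t = i.+1).
Hypothesis t_sorted : sorted leq (map val t).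
Hypothesis t_ge : forall k, k \in t -> (i <= k.+1)%N.

Let tt (s : nat) : nat := nth 0%N (map val t) s.

Let tt_lt (s : 'I_i.+1) : (i <= (tt s).+1 <= e.+1)%N.
Proof.
rewrite /tt (nth_map ord0) ?size_t //.
by rewrite ltn_ord andbT; apply: t_ge; apply: mem_nth; rewrite size_t.
Qed.

(** The column whose entry in row [i - s] has index sum [(tt s).+1], that is, the variable numbered
    [tt s]. Adding [s] turns weakly increasing indices into strictly increasing columns. *)
Let tau (s : 'I_i.+1) : nat := ((tt s).+1 + s - i)%N.

Let tau_mono (s s' : 'I_i.+1) : (s < s')%N -> (tau s < tau s')%N.
Proof.
move=> ss'; have := tt_lt s; have := tt_lt s'; rewrite /tau.
suff : (tt s <= tt s')%N by lia.
apply: (sorted_leq_nth leq_trans leqnn) => //; rewrite ?inE ?size_map ?size_t //.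
exact: ltnW.
Qed.

Let ie : (i < e.+2)%N.
Proof. by have := tt_lt ord0; lia. Qed.

Lemma block_lead : leadset m K i (\sum_(k <- t) U_(k))%MM.
Proof.
pose r (k : 'I_i.+1) : 'I_e.+2 := inord k.
pose c (s : 'I_i.+1) : 'I_e.+2 := inord (tau s).
have rE k : r k = k :> nat by rewrite inordK // (leq_trans (ltn_ord k)).
have cE s : c s = tau s :> nat.
  by rewrite inordK // /tau; have := tt_lt s; have := ltn_ord s; lia.
have uE : (\sum_(k <- t) U_(k))%MM = term_mon e tau (rev_perm i).
  rewrite (big_nth ord0) size_t big_mkord (reindex_inj rev_ord_inj) /=.
  apply: eq_bigr => k _; rewrite permE /hvar; congr U_(_)%MM; apply: val_inj.
  rewrite /= inordK /tau; last by have := tt_lt (rev_ord k); have := ltn_ord k; rewrite /=; lia.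
  have := tt_lt (rev_ord k); have := ltn_ord k; rewrite /= /tt.
  by rewrite (nth_map ord0) ?size_t /=; lia.
exists (\det (mxsub r c X)).
  have ie' : (i.-1 < e.+1)%N by move: i_gt0 ie; lia.
  have := @weighted_sum_gen _ e.+1 (@calJ K e.+2 m) i.-1 ie'.
  rewrite prednK //; apply.
  apply: sub_idgen; exists r, c; split=> // k l kl.
  by rewrite !cE tau_mono.
split; first exact: det_hom.
rewrite uE; pose f (s : 'S_i.+1) : {mpoly K[e.+1]} :=
  if [forall k : 'I_i.+1, 0 < k + tau (s k) < e.+2]%N then 'X_[term_mon e tau s] else 0.
have detE : modx1 (\det (mxsub r c X)) = \sum_(s : 'S_i.+1) (-1) ^+ s * f s.
  rewrite rmorph_sum; apply: eq_bigr => s _ /=; rewrite rmorphM rmorph_sign.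
  congr (_ * _); rewrite rmorph_prod /= /f.
  under eq_bigr => k _ do rewrite mxE modx1_Xmat rE cE.
  case: ifPn => [/forallP sP|/forallPn[k kP]].
    rewrite /term_mon (big_morph _ (@mpolyXD _ _) (@mpolyX0 _ _)).
    by apply: eq_bigr => k _; rewrite sP.
  by rewrite (bigD1 k) //= (negPf kP) mul0r.
have f_rev : f (rev_perm i) = 'X_[term_mon e tau (rev_perm i)].
  rewrite /f ifT //; apply/forallP => k; rewrite permE /tau.
  by have := tt_lt (rev_ord k); have := ltn_ord k; rewrite /=; lia.
have f_lt s v : s != rev_perm i -> (f s)@_v != 0 ->
    mdeg v = mdeg (term_mon e tau (rev_perm i)) /\ (term_mon e tau (rev_perm i) < v)%O.
  rewrite /f; case: forallP => [sP srev|]; last by rewrite mcoeff0 eqxx.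
  rewrite mcoeffX; case: (eqVneq (term_mon e tau s) v) => [<- _|]; last by rewrite eqxx.
  by rewrite !mdeg_term_mon; split=> //; apply: term_mon_rev_lt.
have signE (s : 'S_i.+1) v : (((-1) ^+ s * f s)@_v != 0) = ((f s)@_v != 0).
  by rewrite mulr_sign; case: ifP => // _; rewrite mcoeffN oppr_eq0.
split.
  rewrite detE raddf_sum (bigD1 (rev_perm i)) //= big1 => [|s srev].
    by rewrite addr0 signE f_rev mcoeffX eqxx oner_eq0.
  apply/eqP/contraT; rewrite signE => /(f_lt _ _ srev)[_].
  by rewrite ltxx.
move=> v; rewrite detE raddf_sum /= => sv.
have [s] : exists s : 'S_i.+1, ((-1) ^+ s * f s)@_v != 0.
  apply: contrapT => /forallNP sP; case/eqP: sv; apply: big1 => s _.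
  by apply/eqP/contraT => /sP.
rewrite signE; have [->|srev] := eqVneq s (rev_perm i); last first.
  by move=> /(f_lt _ _ srev)[-> /ltW].
by rewrite f_rev mcoeffX; case: (eqVneq (term_mon e tau (rev_perm i)) v) => [<-|]; rewrite ?eqxx.
Qed.

End Blocks.

(** * Monomials of I_n as leading monomials *)

Section InitialForms.
Variables (e m : nat) (K : fieldType).
Hypothesis m_gt0 : (0 < m)%N.
Local Notation mon := 'X_{1..e.+1}.
Implicit Types u v : mon.

(** The degree in x_(i+1), ..., x_d, index [k] standing for x_(k+2). *)
Definition high_deg i u := (\sum_(k < e.+1 | i <= k.+1) u k)%N.

Lemma JT'_high_deg i (f : {mpoly K[e.+1]}) : @JT' K e.+2 i f ->
  forall u, u \in msupp f -> (i < high_deg i u)%N.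
Proof.
pose L s u := (s <= high_deg i u)%N.
have HL : mon_filtration L.
  split=> // a b u v; rewrite /L => au bv.
  suff -> : high_deg i (u + v)%MM = (high_deg i u + high_deg i v)%N by apply: leq_add.
  by rewrite -big_split; apply: eq_bigr => k _; rewrite mnmDE.
have HF := mon_filtrationP K HL; have [Fid _ _] := HF.
apply: (idexp_least HF); apply: idgen_sub; first exact: Fid.
move=> _ [k ik ->] u; rewrite msuppX inE => /eqP ->.
by rewrite /L /high_deg (bigD1 k) //= mnm1E eqxx.
Qed.

Lemma high_deg_split i s u : (s <= high_deg i u)%N -> exists (t : seq 'I_e.+1) v,
  [/\ size t = s, forall k, k \in t -> (i <= k.+1)%N
    & u = ((\sum_(k <- t) U_(k)) + v)%MM].
Proof.
elim: s u => [|s IH] u su; first by exists [::], u; rewrite big_nil add0m.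
have [k /andP[ik uk]] : exists k : 'I_e.+1, (i <= k.+1)%N && (0 < u k)%N.
  apply: contrapT => /forallNP k0; move: su; rewrite /high_deg big1 // => k ik.
  by apply/eqP; rewrite -leqn0 leqNgt; apply/negP => uk; apply: (k0 k); rewrite ik.
have uE := mnm_subU uk.
have [t [v [ts ti vE]]] : exists (t : seq 'I_e.+1) v, [/\ size t = s,
    forall k, k \in t -> (i <= k.+1)%N
    & (u - U_(k))%MM = ((\sum_(k <- t) U_(k)) + v)%MM].
  apply: IH; move: su; rewrite /high_deg (bigD1 k) //= [in X in _ -> X](bigD1 k) //=.
  rewrite mnmBE mnm1E eqxx; under [in X in _ -> X]eq_bigr => j /andP[_ jk].
    by rewrite mnmBE mnm1E eq_sym (negPf jk) subn0; over.
  lia.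
exists (k :: t), v; split=> [|j|]; first by rewrite /= ts.
  by rewrite inE => /orP[/eqP -> //|]; apply: ti.
by rewrite big_cons -addmA -vE.
Qed.

Lemma JT'_leadset i (f : {mpoly K[e.+1]}) : (0 < i)%N -> @JT' K e.+2 i f ->
  forall u, u \in msupp f -> leadset m K i u.
Proof.
move=> i0 /JT'_high_deg fi u /fi /high_deg_split[t [v [ts ti ->]]].
have [L0 LD] := leadset_filtration e m K.
rewrite -[i]addn0; apply: (LD) => //.
pose t' := sort (relpre val leq) t.
have tt' : perm_eq t t' by rewrite perm_sym perm_sort.
rewrite (perm_big t' tt'); apply: block_lead => //.
- by rewrite size_sort.
- rewrite sorted_map; apply: sort_sorted => x y; exact: leq_total.
- by move=> k; rewrite mem_sort; apply: ti.
Qed.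

Lemma IT'_leadset n (f : {mpoly K[e.+1]}) : IT' K e.+2 n f ->
  forall u, u \in msupp f -> leadset m K n u.
Proof.
have HF := mon_filtrationP K (leadset_filtration e m K).
by apply: (weighted_sum_least HF) => i _ g gi; apply: JT'_leadset gi.
Qed.

End InitialForms.

(** * Standard monomials *)

(** Rows that generate all unit vectors give a left inverse of a square matrix; it is also a right
    inverse, so the rows are independent. *)
Lemma square_indep (K : fieldType) (J : finType) (M : J -> J -> K) :
  (forall j, exists c : J -> K, forall j', \sum_i c i * M i j' = (j == j')%:R) ->
  forall c : J -> K, (forall j', \sum_i c i * M i j' = 0) -> forall i, c i = 0.
Proof.
move=> /choice[C CP] c cM i.
pose A := \matrix_(i < #|J|, j < #|J|) M (enum_val i) (enum_val j).
pose B := \matrix_(i < #|J|, j < #|J|) C (enum_val i) (enum_val j).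
have sumJ (F : J -> K) : \sum_j F j = \sum_(k < #|J|) F (enum_val k).
  by rewrite (reindex (enum_val (A := J))) //; exact/onW_bij/enum_val_bij.
have BA : B *m A = 1%:M.
  apply/matrixP => k l; rewrite !mxE; under eq_bigr => x _ do rewrite !mxE.
  rewrite -(sumJ (fun j => C _ j * M j _)) CP (inj_eq enum_val_inj).
  by [].
pose v := \row_(k < #|J|) c (enum_val k).
have vA : v *m A = 0.
  apply/rowP => l; rewrite !mxE; under eq_bigr => x _ do rewrite !mxE.
  by rewrite -(sumJ (fun j => c j * M j _)) cM.
have v0 : v = 0 by rewrite -[v]mulmx1 -(mulmx1C BA) mulmxA vA mul0mx.
by have := congr1 (fun x : 'rV_#|J| => x ord0 (enum_rank i)) v0; rewrite !mxE enum_rankK.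
Qed.

(** * Spanning modulo [calI] by standard monomials over k[x_1] *)

Section StandardSpan.
Variables (e m : nat) (K : fieldType).
Hypothesis m_gt0 : (0 < m)%N.
Local Notation mon := 'X_{1..e.+1}.
Local Notation T := {mpoly K[e.+2]}.
Local Notation T' := {mpoly K[e.+1]}.
Local Notation wd := (wdeg (@curve_weight e.+2 m)).
Local Notation hom := (whomog (@curve_weight e.+2 m)).
Local Notation modx1 := (@modx1 K e.+2).
Local Notation X0 := ('X_ord0 : T).
Implicit Types (u : 'X_{1..e.+2}) (v : mon) (p q s : T).

Variable n : nat.
Local Notation I := (calI K e.+2 m n).
Local Notation J := ('I_e.+2 * 'X_{1..e.+1 < n})%type.
Implicit Type j : J.

Definition bmon j : mon := std_mon j.1 j.2.
Definition bwt j := wd (emb (bmon j)).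
(** Since x_1 has weight [e.+2], this says that some power of x_1 brings the standard monomial to
    weight [w]; [bext] is the product. *)
Definition bok w j := (bwt j <= w)%N && (e.+2 %| w - bwt j)%N.
Definition bext w j : 'X_{1..e.+2} :=
  (U_(ord0) *+ ((w - bwt j) %/ e.+2) + emb (bmon j))%MM.

Lemma wd0 k : wd (U_(ord0) *+ k)%MM = (e.+2 * k)%N.
Proof.
elim: k => [|k IH]; first by rewrite mulm0n wdeg0 muln0.
by rewrite mulmS wdegD IH wdeg1 mulnS /curve_weight mul0n addn0.
Qed.

Lemma bokE w j : (bwt j <= w)%N -> bok w j = (bwt j %% e.+2 == w %% e.+2)%N.
Proof. by move=> jw; rewrite /bok jw /= -eqn_mod_dvd // eq_sym. Qed.

Lemma bok_shift w j k : bok w j -> bok (w + e.+2 * k) j.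
Proof.
move=> /andP[bw db]; rewrite /bok (leq_trans bw) ?leq_addr //=.
by rewrite -addnBAC // dvdn_addl // dvdn_mulr.
Qed.

Lemma bext_shift w j k : bok w j ->
  bext (w + e.+2 * k) j = (U_(ord0) *+ k + bext w j)%MM.
Proof.
move=> /andP[bw db]; rewrite /bext -addnBAC // divnDl // mulKn //.
rewrite addmA addnC; congr (_ + _)%MM; apply/mnmP => i.
by rewrite mnmDE !mulmnE mulnDr.
Qed.

Definition span w s :=
  exists c : J -> K, s = \sum_(j | bok w j) c j *: 'X_[bext w j].

Lemma span0 w : span w 0.
Proof. by exists (fun=> 0); rewrite big1 // => j _; rewrite scale0r. Qed.

Lemma spanD w s s' : span w s -> span w s' -> span w (s + s').
Proof.
move=> [c ->] [c' ->]; exists (fun j => c j + c' j); rewrite -big_split.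
by apply: eq_bigr => j _; rewrite scalerDl.
Qed.

Lemma spanZ w a s : span w s -> span w (a *: s).
Proof.
move=> [c ->]; exists (fun j => a * c j); rewrite scaler_sumr.
by apply: eq_bigr => j _; rewrite scalerA.
Qed.

Lemma span_shift w s k : span w s -> span (w + e.+2 * k) (X0 ^+ k * s).
Proof.
move=> [c ->]; exists (fun j => if bok w j then c j else 0).
rewrite mulr_sumr big_mkcond [RHS]big_mkcond; apply: eq_bigr => j _ /=.
have [wj|] := boolP (bok w j); last by rewrite scale0r if_same.
by rewrite bok_shift // bext_shift // mpolyXD -mpolyXn -scalerAr.
Qed.

Lemma span_bmon j : span (bwt j) 'X_[emb (bmon j)].
Proof.
have ok : bok (bwt j) j by rewrite /bok leqnn subnn dvdn0.
exists (fun i => (i == j)%:R); rewrite (bigD1 j) //= eqxx scale1r.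
rewrite {1}/bext subnn div0n mulm0n add0m big1 ?addr0 // => i /andP[_ /negPf ->].
by rewrite scale0r.
Qed.

(** [Q] records what is known of the remainder modulo x_1, such as a lower bound on its monomials or
    the absence of one of them. *)
Definition reducible (Q : T -> Prop) w q := exists s, [/\ span w s, I (q - s) & Q s].

Definition lin_closed (Q : T -> Prop) :=
  [/\ Q 0, forall s s', Q s -> Q s' -> Q (s + s') & forall a s, Q s -> Q (a *: s)].

Lemma reducible_lin Q w q : lin_closed Q ->
  (forall u, u \in msupp q -> reducible Q w 'X_[u]) -> reducible Q w q.
Proof.
move=> [Q0 QD QZ] qQ; have [I_id _ _] := calI_filtration e m K.
have [I0 ID IM] := I_id n.
rewrite (mpolyE q) big_seq; apply: (big_ind (reducible Q w)).
- by exists 0; split; rewrite ?subr0 //; apply: span0.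
- move=> x y [s [sw sI sQ]] [s' [sw' sI' sQ']]; exists (s + s'); split.
  + exact: spanD.
  + by rewrite opprD addrACA; apply: ID.
  + exact: QD.
- move=> u /qQ[s [sw sI sQ]]; exists (q@_u *: s); split.
  + exact: spanZ.
  + by rewrite -scalerBr -mul_mpolyC; apply: IM.
  + exact: QZ.
Qed.

Definition above v (s : T) :=
  forall x, (modx1 s)@_x != 0 -> mdeg x = mdeg v /\ (v <= x)%O.

Lemma modx1Z a (s : T) : modx1 (a *: s) = a *: modx1 s.
Proof. by apply/mpolyP => x; rewrite mcoeffZ !mcoeff_modx1 mcoeffZ. Qed.

Lemma above_lin v : lin_closed (above v).
Proof.
split=> [x|s s' vs vs' x|a s vs x]; first by rewrite rmorph0 mcoeff0 eqxx.
  rewrite rmorphD mcoeffD; have [s0|/vs //] := eqVneq (modx1 s)@_x 0.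
  by rewrite s0 add0r; apply: vs'.
by rewrite modx1Z mcoeffZ mulf_eq0 negb_or => /andP[_ /vs].
Qed.

(** Divide by x_1, reduce in the smaller weight and multiply back; the remainder then vanishes
    modulo x_1. *)
Lemma reducible_mulX0 Q w u :
  (forall w' q, (w' < w)%N -> hom w' q -> reducible (fun=> True) w' q) ->
  (forall s, modx1 s = 0 -> Q s) -> u ord0 != 0%N ->
  wd u = w -> reducible Q w 'X_[u].
Proof.
move=> IH Q_mod u0 uw; have [I_id _ _] := calI_filtration e m K.
have [I0 ID IM] := I_id n.
rewrite -lt0n in u0; have uE := mnm_subU u0.
have wE : w = (wd (u - U_(ord0))%MM + e.+2 * 1)%N.
  by rewrite -uw {1}uE wdegD wdeg1 /curve_weight mul0n; lia.
have [||s [ws Is _]] := IH (wd (u - U_(ord0))%MM) 'X_[u - U_(ord0)].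
- by rewrite [X in (_ < X)%N]wE; lia.
- exact: whomogX.
exists (X0 ^+ 1 * s); split; first by rewrite wE; apply: span_shift.
  by rewrite {1}uE mpolyXD expr1 -mulrBr; apply: IM.
apply: Q_mod; rewrite expr1 rmorphM /= (modx1X K U_(ord0)) mnm1E eqxx /=.
by rewrite mul0r.
Qed.

(** Induction on the weight, then on the number of monomials above [v]. A nonstandard [v] is the
    leading monomial of an element of [I]; subtracting a multiple leaves terms divisible by x_1 and
    monomials of the same degree above [v]. *)
Lemma reducible_hom w : 
  (forall q, hom w q -> reducible (fun=> True) w q) /\
  (forall v, wd (emb v) = w -> reducible (above v) w 'X_[emb v]).
Proof.
have [w0 le_w0] := ubnP w; elim: w0 w le_w0 => // w0 IH w le_w0.
have [I_id _ _] := calI_filtration e m K.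
have [I0 ID IM] := I_id n.
have red0 Q u : (forall s, modx1 s = 0 -> Q s) -> u ord0 != 0%N ->
    wd u = w -> reducible Q w 'X_[u].
  move=> Q0 u0 uw; apply: reducible_mulX0 => // w' q w'w.
  have lt0 : (w' < w0)%N by rewrite ltnS in le_w0; apply: leq_trans le_w0.
  exact: (proj1 (IH w' lt0)).
have redv v : wd (emb v) = w -> reducible (above v) w 'X_[emb v].
  have [k] := ubnP #|[pred x : 'X_{1..e.+1 < (mdeg v).+1} | (v < x)%O]|.
  elim: k v => // k IHk v le_k vw.
  have [Iv|[c [x [cd xn vE]]]] := std_mon_or K v n; last first.
    pose j : J := (Ordinal cd, BMultinom xn).
    have {}vE : v = bmon j by [].
    exists 'X_[emb v]; split; last 1 first.
    - move=> y; rewrite modx1X emb0 eqxx embK mcoeffX.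
      by case: (eqVneq v y) => [->|]; rewrite ?eqxx.
    - by rewrite -vw vE; apply: span_bmon.
    - by rewrite subrr.
  have vS : v \in msupp ('X_[v] : T') by rewrite msuppX inE.
  have [E EI Ev] := IT'_leadset m_gt0 Iv vS.
  have Ehom := lead_hom Ev; have [_ [Ev0 Evm]] := Ev.
  pose q := 'X_[emb v] - ((modx1 E)@_v)^-1 *: E.
  have qw : hom w q by rewrite -vw; apply: whomogB; [apply: whomogX | apply: whomogZ].
  have [s [sw sI sQ]] : reducible (above v) w q.
    apply: reducible_lin; first exact: above_lin.
    move=> u; rewrite mcoeff_msupp => qu; have uw := qw u qu.
    have [u0|u0] := eqVneq (u ord0) 0%N; last first.
      by apply: red0 => // s s0 x; rewrite s0 mcoeff0 eqxx.
    have uE := emb_rest u0; move: qu; rewrite -uE -mcoeff_modx1 rmorphB /= modx1Z.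
    rewrite modx1X emb0 eqxx embK mcoeffB mcoeffX mcoeffZ.
    have [<-|vx] := eqVneq v (rest u); first by rewrite mulVf // subrr eqxx.
    rewrite sub0r oppr_eq0 mulf_eq0 negb_or => /andP[_ /Evm[dx vx']].
    have {}vx : (v < rest u)%O by rewrite lt_neqAle vx.
    have [||s [sw sI sQ]] := IHk (rest u); last 1 first.
    - exists s; split=> // y /sQ[-> /(le_trans vx')]; by rewrite dx.
    - rewrite ltnS in le_k; apply: leq_trans le_k; rewrite dx.
      have xb : (mdeg (rest u) < (mdeg v).+1)%N by rewrite dx.
      apply: proper_card; apply/properP; split.
        by apply/fintype.subsetP => y; rewrite !inE; apply: lt_trans.
      by exists (BMultinom xb); rewrite inE //= ltxx.
    - by rewrite uE.
  exists s; split=> //; move: sI; rewrite /q => sI.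
  rewrite -[X in X - s](subrK (((modx1 E)@_v)^-1 *: E)) addrAC; apply: ID => //.
  by rewrite -mul_mpolyC; apply: IM.
split=> // q qw; apply: reducible_lin => // u; rewrite mcoeff_msupp => qu.
have [u0|u0] := eqVneq (u ord0) 0%N; last by apply: red0 => //; apply: qw.
rewrite -(emb_rest u0); have [|s [? ? _]] := redv (rest u); last by exists s.
by rewrite emb_rest //; apply: qw.
Qed.

End StandardSpan.

(** * Independence of the standard monomials *)

Section Independence.
Variables (e m : nat) (K : fieldType).
Hypothesis m_gt0 : (0 < m)%N.
Local Notation mon := 'X_{1..e.+1}.
Local Notation T := {mpoly K[e.+2]}.
Local Notation T' := {mpoly K[e.+1]}.
Local Notation hom := (whomog (@curve_weight e.+2 m)).
Variable theta : {rmorphism T -> T'}.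
Hypothesis thetaZ : forall a p, theta (a *: p) = a *: theta p.
Hypothesis theta_calI : forall n p, calI K e.+2 m n p -> ord_ge n (theta p).
Hypothesis theta_surj : forall n, exists w0, forall w h, (w0 <= w)%N ->
  exists2 p, hom w p & ord_ge n (theta p - h).

Variable n : nat.
Local Notation J := ('I_e.+2 * 'X_{1..e.+1 < n})%type.
Local Notation bwt := (@bwt e m n).
Local Notation bok := (@bok e m n).
Local Notation bext := (@bext e m n).

(** The images of the standard monomials, raised to large weights, form a square matrix. Spanning
    and surjectivity give it a left inverse, and [square_indep] concludes. *)
Lemma span_indep w (s : T) : span m n w s -> ord_ge n (theta s) -> s = 0.
Proof.
move=> [c ->] {s} os; have [w0 w0P] := theta_surj n.
(* Makes the weights [wr r], one for each residue, at least [w], [w0] and every [bwt j]. *)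
pose L := (w0 + w + \max_(j : J) bwt j)%N.
pose wr r := (e.+2 * L + r)%N.
have wr_ge r j : (bwt j <= wr r)%N.
  have : (bwt j <= \max_(j : J) bwt j)%N by apply: leq_bigmax.
  by rewrite /wr /L; nia.
have wr_mod (r : 'I_e.+2) : (wr r %% e.+2)%N = r.
  by rewrite /wr mulnC modnMDl modn_small.
(* Rows are standard monomials; columns are pairs of a residue and a monomial of degree below [n].
   Both are indexed by [J]. *)
pose M (j j' : J) := if (bwt j %% e.+2 == j'.1)%N
  then (theta 'X_[bext (wr j'.1) j])@_(j'.2) else 0.
have span_row (r : 'I_e.+2) (c' : J -> K) (j' : J) :
    \sum_j (if bok (wr r) j then c' j else 0) * M j j'
    = if r == j'.1 then (theta (\sum_(j | bok (wr r) j) c' j *: 'X_[bext (wr r) j]))@_(j'.2) else 0.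
  have [rj|rj] := eqVneq r j'.1; last first.
    apply: big1 => j _; rewrite bokE // wr_mod /M; case: eqP => [->|]; last by rewrite mul0r.
    by rewrite (inj_eq val_inj) (negPf rj) mulr0.
  rewrite rmorph_sum raddf_sum [RHS]big_mkcond; apply: eq_bigr => j _ /=.
  case: ifP => jr; last by rewrite mul0r.
  by rewrite thetaZ mcoeffZ /M -rj; move: jr; rewrite bokE // wr_mod => ->.
(* A preimage of the chosen monomial up to order [n] reduces to the span without changing its image
   below degree [n]. *)
have Mfull (j : J) : exists c' : J -> K, forall j', \sum_i c' i * M i j' = (j == j')%:R.
  have [|p pw pj] := w0P (wr j.1) 'X_[j.2]; first by rewrite /wr /L; nia.
  have [red _] := reducible_hom e K m_gt0 n (wr j.1).
  have [s' [[c' sE] pI _]] := red p pw.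
  exists (fun i => if bok (wr j.1) i then c' i else 0) => j'.
  rewrite span_row -sE; have [jj'|jj'] := eqVneq j.1 j'.1; last first.
    by rewrite (_ : (j == j') = false) //; apply: contraNF jj' => /eqP ->.
  have d' : (mdeg j'.2 < n)%N by apply: bmdeg.
  have := pj _ d'; rewrite mcoeffB => /eqP; rewrite subr_eq0 => /eqP pX.
  have := theta_calI pI d'; rewrite rmorphB mcoeffB pX => /eqP.
  rewrite subr_eq0 => /eqP <-; rewrite mcoeffX; congr (nat_of_bool _)%:R.
  by have -> : (j == j') = (j.1 == j'.1) && (j.2 == j'.2) by []; rewrite jj' eqxx.
pose r : 'I_e.+2 := Ordinal (ltn_pmod w (ltn0Sn e.+1)).
have wL : (w %/ e.+2 <= L)%N by have := leq_div w e.+2; rewrite /L; lia.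
have wrE : wr r = (w + e.+2 * (L - w %/ e.+2))%N.
  by rewrite /wr /= {2}(divn_eq w e.+2) mulnBr; nia.
have cE j : (if bok w j then c j else 0)
    = if bok (wr r) j then (if bok w j then c j else 0) else 0.
  by case: (boolP (bok w j)) => [wj|]; rewrite ?if_same // wrE bok_shift.
have c0 : forall j, (if bok w j then c j else 0) = 0.
  apply: (square_indep Mfull) => j'.
  under eq_bigr => j _ do rewrite cE.
  rewrite span_row; case: ifP => // _.
  (* A power of x_1 moves the combination to weight [wr r] with the same coefficients, and its image
     keeps order [n]. *)
  have -> : \sum_(j | bok (wr r) j) (if bok w j then c j else 0) *: 'X_[bext (wr r) j]
      = 'X_ord0 ^+ (L - w %/ e.+2) * \sum_(j | bok w j) c j *: 'X_[bext w j].
    rewrite mulr_sumr big_mkcond [RHS]big_mkcond; apply: eq_bigr => j _.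
    rewrite wrE; have [wj|] := boolP (bok w j); last by rewrite scale0r if_same.
    by rewrite bok_shift // bext_shift // mpolyXD -mpolyXn -scalerAr.
  have [_ _ oM] := ord_ge_ideal e.+1 K n.
  by rewrite rmorphM; apply: (oM _ _ os); apply: bmdeg.
by apply: big1 => j wj; have := c0 j; rewrite wj => ->; rewrite scale0r.
Qed.

(* Reduce [p] to the span of the standard monomials; the remainder is killed
   because it still has order at least [n]. *)
Lemma calI_of_ord w p : hom w p -> ord_ge n (theta p) -> calI K e.+2 m n p.
Proof.
move=> pw op; have [red _] := reducible_hom e K m_gt0 n w.
have [s [sw pI _]] := red p pw.
suff s0 : s = 0 by rewrite -[p]subr0 -s0.
apply: (span_indep sw); have := idealB (ord_ge_ideal _ _ n) op (theta_calI pI).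
by rewrite rmorphB /= opprB addrCA subrr addr0.
Qed.

(** If [v] were standard, reducing the other terms of [q] would give a combination of standard
    monomials with image of order [n] and nonzero coefficient at [v], against [span_indep]. *)
Lemma leading_mem_IT' w (q : T) v : hom w q -> ord_ge n (theta q) ->
  (modx1 q)@_v != 0 ->
  (forall x, (modx1 q)@_x != 0 -> x != v -> mon_gt v x) -> IT' K e.+2 n 'X_[v].
Proof.
move=> qw oq qv vlead; have [//|[a [x [ad xn vE]]]] := std_mon_or K v n.
pose j : J := (Ordinal ad, BMultinom xn); have {}vE : v = bmon j by [].
have vw : wdeg (@curve_weight e.+2 m) (emb v) = w by apply: qw; rewrite -mcoeff_modx1.
pose Q (s : T) := (modx1 s)@_v = 0.
have Ql : lin_closed Q.
  split=> [|s s' Qs Qs'|b s Qs]; first by rewrite /Q rmorph0 mcoeff0.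
    by rewrite /Q rmorphD mcoeffD Qs Qs' addr0.
  by rewrite /Q modx1Z mcoeffZ Qs mulr0.
have [red redv] := reducible_hom e K m_gt0 n w.
pose b := (modx1 q)@_v; pose q' := q - b *: 'X_[emb v].
have modE y : (modx1 q')@_y = (modx1 q)@_y - b * (v == y)%:R.
  by rewrite rmorphB mcoeffB /= modx1Z modx1X emb0 eqxx embK mcoeffZ mcoeffX.
have [s [sw sI Qs]] : reducible m n Q w q'.
  apply: reducible_lin => // u; rewrite mcoeff_msupp => qu.
  have uw : wdeg (@curve_weight e.+2 m) u = w.
    have : hom w q' by apply: whomogB => //; rewrite -vw; apply/whomogZ/whomogX.
    exact.
  have [u0|u0] := eqVneq (u ord0) 0%N; last first.
    apply: reducible_mulX0 => // [w' p _|s s0]; last by rewrite /Q s0 mcoeff0.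
    exact: (proj1 (reducible_hom e K m_gt0 n w')).
  have uE := emb_rest u0.
  have ruv : rest u != v.
    apply: contraNneq qu => ruv.
    by rewrite -uE -mcoeff_modx1 modE ruv eqxx mulr1 subrr.
  have qr : (modx1 q)@_(rest u) != 0.
    have : (modx1 q')@_(rest u) != 0 by rewrite mcoeff_modx1 uE.
    by rewrite modE [v == _]eq_sym (negPf ruv) mulr0 subr0.
  rewrite -uE; have [|s [sw sI sab]] := redv (rest u); first by rewrite uE.
  (* The remainder has only monomials of the degree of [rest u] and not below it, while a leading
     [v] of that degree is below it. *)
  exists s; split=> //; apply/eqP/contraT => /sab[dv ruv'].
  have [|[_ [k kP1 kP2]]] := vlead _ qr ruv; first by rewrite dv ltnn.
  suff : (v < rest u)%O by rewrite ltNge ruv'.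
  by apply/ltmcP => //; exists k.
have S0 : b *: 'X_[emb v] + s = 0.
  apply: (@span_indep w).
    by apply: spanD => //; apply: spanZ; rewrite -vw vE; apply: span_bmon.
  have := idealB (ord_ge_ideal _ _ n) oq (theta_calI sI).
  by rewrite -rmorphB (_ : q - (q' - s) = b *: 'X_[emb v] + s) // /q'; ring.
have := congr1 (fun p : T => (modx1 p)@_v) S0.
rewrite rmorph0 rmorphD mcoeffD /= Qs modx1Z modx1X emb0 eqxx embK mcoeffZ mcoeffX.
by rewrite eqxx mulr1 mcoeff0 addr0 => b0; move: qv; rewrite -/b b0 eqxx.
Qed.

End Independence.

(** * A deformation of the point (1, ..., 1) *)

Section Deformation.
Variables (e m : nat) (K : fieldType).
Hypothesis co_dm : coprime e.+2 m.
Local Notation T := {mpoly K[e.+2]}.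
Local Notation T' := {mpoly K[e.+1]}.
Local Notation hom := (whomog (@curve_weight e.+2 m)).
Implicit Types (p q : T) (h : T').

Variables (al de : nat).
Hypothesis al_de : (de * e.+2 = al * m + 1)%N.

(** By [al_de] the images of x_2^d and x_1^(d+m) are powers of [1 + 'X_ord0] with consecutive
    exponents; hence no characteristic is excluded. *)
Definition coord (i : 'I_e.+2) : T' := (1 + 'X_ord0) ^+ (al + i * de)
  * (if (1 < i)%N then 1 + 'X_(inord i.-1) else 1).

Definition theta : {rmorphism T -> T'} := mmap (@mpolyC e.+1 K) coord.

Lemma thetaZ a p : theta (a *: p) = a *: theta p.
Proof. by rewrite /theta /= mmapZ mul_mpolyC. Qed.

Lemma thetaX i : theta 'X_i = coord i.
Proof. by rewrite /theta /= mmapX mmap1U. Qed.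

Lemma mcoeff0M h h' : (h * h')@_0%MM = h@_0%MM * h'@_0%MM.
Proof. by apply: (@mcoeffM_lowest _ _ 0) => //; rewrite mdeg0. Qed.

Lemma mcoeff0_expr h k : h@_0%MM = 1 -> (h ^+ k)@_0%MM = 1.
Proof.
move=> h1; elim: k => [|k IH]; first by rewrite expr0 mcoeff1 eqxx.
by rewrite exprS mcoeff0M h1 IH mulr1.
Qed.

Lemma mcoeff0_1X (i : 'I_e.+1) : (1 + 'X_i : T')@_0%MM = 1.
Proof. by rewrite mcoeffD mcoeff1 eqxx mcoeffX -mdeg_eq0 mdeg1 addr0. Qed.

Lemma mcoeff0_coord i : (coord i)@_0%MM = 1.
Proof.
rewrite /coord mcoeff0M mcoeff0_expr ?mcoeff0_1X // mul1r.
by case: ifP => _; rewrite ?mcoeff0_1X // mcoeff1 eqxx.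
Qed.

Lemma theta1 p : (theta p)@_0%MM = p.@[fun=> 1].
Proof.
elim/mpolyind: p => [|c u p _ _ IH]; first by rewrite !rmorph0 ?mcoeff0.
rewrite !rmorphD /= IH; congr (_ + _); rewrite mmapZ mevalZ mcoeff0M.
rewrite mcoeffC eqxx mulr1 mevalX mmapX /mmap1; congr (_ * _).
rewrite [RHS]big1 => [|i _]; last by rewrite expr1n.
apply: (big_ind (fun h : T' => h@_0%MM = 1)).
- by rewrite mcoeff1 eqxx.
- by move=> h h' h1 h1'; rewrite mcoeff0M h1 h1' mulr1.
- by move=> i _; apply: mcoeff0_expr; apply: mcoeff0_coord.
Qed.

Let x1 : T := 'X_ord0.
Let x2 : T := 'X_(inord 1).

(* Binomials of the curve mapped by [theta] to the variables, up to units. *)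
Definition gbin (k : 'I_e.+1) : T :=
  if k == ord0 then x2 ^+ e.+2 - x1 ^+ (e.+2 + m)
  else 'X_(inord k.+1) * x1 ^+ k - x2 ^+ k.+1.

Definition gwt (k : 'I_e.+1) : nat :=
  (if k == ord0 then e.+2 * (e.+2 + m) else k.+1 * (e.+2 + m))%N.

Lemma hom_x1 : hom e.+2 x1.
Proof.
have := @whomogX _ K (@curve_weight e.+2 m) U_(ord0).
by rewrite wdeg1 /curve_weight mul0n addn0.
Qed.

Lemma hom_x2 : hom (e.+2 + m) x2.
Proof.
have := @whomogX _ K (@curve_weight e.+2 m) U_(inord 1).
by rewrite wdeg1 /curve_weight inordK // mul1n.
Qed.

Lemma hom_gbin k : hom (gwt k) (gbin k).
Proof.
rewrite /gbin /gwt; case: eqP => [_|k0]; apply: whomogB.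
- by rewrite mulnC; apply/whomog_expr/hom_x2.
- by apply/whomog_expr/hom_x1.
- have kl : (k.+1 < e.+2)%N by have := ltn_ord k; lia.
  have := @whomogX _ K (@curve_weight e.+2 m) U_(inord k.+1).
  rewrite wdeg1 /curve_weight inordK // => hk.
  have -> : (k.+1 * (e.+2 + m) = (e.+2 + k.+1 * m) + e.+2 * k)%N by nia.
  by apply: whomogM => //; apply/whomog_expr/hom_x1.
- by rewrite mulnC; apply/whomog_expr/hom_x2.
Qed.

(** For [k = 0] the exponents differ by 1. Otherwise both terms have the same power of
    [1 + 'X_ord0], and only the first has the factor [1 + 'X_k]. *)
Lemma theta_gbin k : exists2 h, h@_0%MM = 1 & theta (gbin k) = 'X_k * h.
Proof.
have tx1 : theta x1 = (1 + 'X_ord0) ^+ al by rewrite thetaX /coord mulr1 mul0n addn0.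
have tx2 : theta x2 = (1 + 'X_ord0) ^+ (al + de).
  by rewrite thetaX /coord inordK // mulr1 mul1n.
rewrite /gbin; case: eqP => [->|k0].
  exists ((1 + 'X_ord0) ^+ (al * (e.+2 + m))).
    by apply: mcoeff0_expr; apply: mcoeff0_1X.
  rewrite rmorphB !rmorphXn /= tx1 tx2 -!exprM.
  have -> : ((al + de) * e.+2 = (al * (e.+2 + m)).+1)%N by lia.
  by rewrite exprS; ring.
exists ((1 + 'X_ord0) ^+ ((al + de) * k.+1)).
  by apply: mcoeff0_expr; apply: mcoeff0_1X.
have k_gt0 : (0 < k)%N by rewrite lt0n; apply/eqP => k0'; apply: k0; apply: val_inj.
have kl : (k.+1 < e.+2)%N by have := ltn_ord k; lia.
rewrite rmorphB rmorphM !rmorphXn /= tx1 tx2 thetaX /coord inordK // ltnS.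
rewrite k_gt0 inord_val -!exprM mulrAC -exprD.
have -> : (al + k.+1 * de + al * k = (al + de) * k.+1)%N by nia.
ring.
Qed.

(** The Chinese remainder theorem gives a multiple of [e.+2 + m] congruent to [w] modulo [e.+2];
    reducing its cofactor modulo [e.+2] keeps it below [w]. *)
Lemma frobenius w : (e.+2 * (e.+2 + m) <= w)%N ->
  exists a b, w = (a * e.+2 + b * (e.+2 + m))%N.
Proof.
move=> wge; have co : coprime e.+2 (e.+2 + m) by rewrite /coprime gcdnDl.
pose x := chinese e.+2 (e.+2 + m) w 0.
have xw : x = w %[mod e.+2] by apply: chinese_modl.
have /dvdnP[b' xb] : (e.+2 + m %| x)%N.
  by rewrite /dvdn /x chinese_modr // mod0n.
pose b := (b' %% e.+2)%N.
have blt : (b < e.+2)%N by rewrite ltn_pmod.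
have bw : (b * (e.+2 + m) <= w)%N by apply: leq_trans wge; rewrite leq_mul2r ltnW ?orbT.
have /dvdnP[a wa] : (e.+2 %| w - b * (e.+2 + m))%N.
  by rewrite -eqn_mod_dvd // -xw xb /b modnMml.
by exists a, b; rewrite -wa subnK.
Qed.

(** Take the product of the binomials with exponents [u], completed to weight [w] by a monomial in
    x_1 and x_2, whose image has constant term 1. *)
Lemma theta_monomial n w (u : 'X_{1..e.+1}) : (mdeg u < n)%N ->
  (n.+1 * (e.+2 * (e.+2 + m)) <= w)%N ->
  exists2 p, hom w p & exists2 h, h@_0%MM = 1 & theta p = 'X_[u] * h.
Proof.
move=> un wge; pose wu := (\sum_(k < e.+1) gwt k * u k)%N.
have gle k : (gwt k <= e.+2 * (e.+2 + m))%N.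
  by rewrite /gwt; case: eqP => // _; rewrite leq_mul2r; have := ltn_ord k; lia.
have wu_le : (wu <= n * (e.+2 * (e.+2 + m)))%N.
  apply: (@leq_trans (mdeg u * (e.+2 * (e.+2 + m)))); last by rewrite leq_mul2r ltnW ?orbT.
  rewrite mdegE big_distrl /=; apply: leq_sum => k _.
  by rewrite mulnC leq_mul2l gle orbT.
(* Of the [n.+1] multiples in the bound, [n] cover the binomials and the last one is left for
   [frobenius]. *)
have [|a [b wab]] := @frobenius (w - wu); first by lia.
exists (x1 ^+ a * x2 ^+ b * \prod_k gbin k ^+ u k).
  have -> : w = (e.+2 * a + (e.+2 + m) * b + wu)%N by lia.
  apply: whomogM; last by apply: whomog_prod => k _; apply/whomog_expr/hom_gbin.
  by apply: whomogM; apply: whomog_expr; [apply: hom_x1 | apply: hom_x2].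
have /choice[H HP] k : exists h, h@_0%MM = 1 /\ theta (gbin k) = 'X_k * h.
  by have [h ? ?] := theta_gbin k; exists h.
exists (theta x1 ^+ a * theta x2 ^+ b * \prod_k H k ^+ u k).
  rewrite !mcoeff0M !mcoeff0_expr ?thetaX ?mcoeff0_coord ?mul1r //.
  apply: (big_ind (fun h : T' => h@_0%MM = 1)).
  - by rewrite mcoeff1 eqxx.
  - by move=> h h' h1 h1'; rewrite mcoeff0M h1 h1' mulr1.
  - by move=> i _; apply: mcoeff0_expr; case: (HP i).
rewrite !rmorphM !rmorphXn rmorph_prod /= [RHS]mulrCA; congr (_ * _).
rewrite mpolyXE_id -big_split /=; apply: eq_bigr => k _.
by rewrite rmorphXn /= -exprMn; congr (_ ^+ _); case: (HP k).
Qed.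

(** Successive approximation: preimages with lowest term ['X_[u]] match the form of degree [k] in
    [h], and the difference has order at least [k.+1]. *)
Lemma theta_surj n : exists w0, forall w h, (w0 <= w)%N ->
  exists2 p, hom w p & ord_ge n (theta p - h).
Proof.
exists (n.+1 * (e.+2 * (e.+2 + m)))%N => w h wge.
have [o0 oD oM] := ord_ge_ideal e.+1 K n.
suff key i : (i <= n)%N -> forall h, ord_ge (n - i) h ->
    exists2 p, hom w p & ord_ge n (theta p - h).
  by apply: (key n (leqnn n)); rewrite subnn.
elim: i => [_ {}h|i IH ni {}h hi].
  rewrite subn0 => hn; exists 0; first exact: whomog0.
  by rewrite rmorph0 sub0r; exact: (idealN (ord_ge_ideal _ _ n) hn).
set k := (n - i.+1)%N in hi; have kE : (n - i = k.+1)%N by rewrite /k; lia.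
have /choice[G GP] (u : 'X_{1..e.+1 < n}) : exists p, hom w p /\
    exists2 h, h@_0%MM = 1 & theta p = 'X_[u] * h.
  by have [p ? ?] := theta_monomial (bmdeg u) wge; exists p.
pose g := \sum_(u : 'X_{1..e.+1 < n} | mdeg u == k) h@_u *: G u.
have gw : hom w g by apply: whomog_sum => u _; apply: whomogZ; case: (GP u).
have thG (u : 'X_{1..e.+1 < n}) v : mdeg u = k -> (mdeg v <= k)%N ->
    (theta (G u))@_v = (u == v :> 'X_{1..e.+1})%:R.
  move=> uk vk; have [_ [h' h'0 ->]] := GP u.
  have uo : ord_ge k ('X_[u] : T').
    move=> x xk; rewrite mcoeffX; case: (eqVneq (u : 'X_{1..e.+1}) x) => // ux.
    by rewrite -ux uk ltnn in xk.
  move: vk; rewrite leq_eqVlt => /orP[/eqP vk|vk].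
    by rewrite mulrC (mcoeffM_lowest _ uo vk) h'0 mul1r mcoeffX.
  have [_ _ oMk] := ord_ge_ideal e.+1 K k; rewrite mulrC (oMk h' _ uo v vk).
  by case: eqP => // uv; rewrite -uv uk ltnn in vk.
have [|p pw pP] := IH (ltnW ni) (h - theta g).
  rewrite kE => v; rewrite ltnS => vk.
  rewrite mcoeffB rmorph_sum raddf_sum /=.
  under eq_bigr => u /eqP uk do rewrite thetaZ mcoeffZ (thG u v uk vk).
  move: vk; rewrite leq_eqVlt => /orP[/eqP vk|vk]; last first.
    rewrite hi // big1 ?subr0 // => u /eqP uk.
    case: eqP => [uv|]; last by rewrite mulr0.
    by rewrite -uv uk ltnn in vk.
  have vn : (mdeg v < n)%N by rewrite vk /k; lia.
  rewrite (bigD1 (BMultinom vn)) /= ?vk // eqxx mulr1 big1 ?addr0 ?subrr //.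
  move=> u /andP[_ uv]; case: eqP => [vu|]; rewrite ?mulr0 //.
  by case/eqP: uv; apply: val_inj.
exists (p + g); first exact: whomogD.
by rewrite rmorphD; move: pP; congr ord_ge; rewrite opprB addrA addrAC.
Qed.

End Deformation.

(** * Symbolic powers of the curve *)

Section SymbolicPowersOfCurve.
Variables (e m : nat) (K : fieldType).
Hypothesis m_gt0 : (0 < m)%N.
Hypothesis co_dm : coprime e.+2 m.
Local Notation w := (@curve_weight e.+2 m).
Local Notation hom := (whomog w).
Local Notation T := {mpoly K[e.+2]}.
Local Notation I n := (calI K e.+2 m n).
Local Notation X := (Xmat K e.+2 m).
Local Notation wc := (wcomp w).

Let w_gt0 (i : 'I_e.+2) : (0 < w i)%N := curve_weight_gt0 m i.

Lemma mpoly_curve_x (i : 'I_e.+2) :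
  mpoly_curve w ('X_i : T) = 'X_ord0 ^+ w i.
Proof. by rewrite /mpoly_curve mmapX mmap1U. Qed.

Lemma mpoly_curve_Xmat (r c : 'I_e.+2) :
  mpoly_curve w (X r c) = 'X_ord0 ^+ (e.+2 + (r + c) * m).
Proof.
rewrite XmatE; case: ltnP => rc.
  by rewrite mpoly_curve_x /curve_weight inordK.
rewrite rmorphM rmorphXn /= !mpoly_curve_x.
rewrite -exprM -exprD /curve_weight; congr (_ ^+ _).
have rcd : (r + c - e.+2 < e.+2)%N by have := ltn_ord r; have := ltn_ord c; lia.
by rewrite inordK // mulnBl mul0n addn0; nia.
Qed.

(** On the curve [X] has rank one, its entries having weights [e.+2 + (r + c) * m], so x_1^i times
    the minor lies in the ordinary power. *)
Lemma calJ_symbolic i : calJ m i `<=` symbolic_power (pT K e.+2 m) i.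
Proof.
have Pp := mcurve_prime K w; have [symid _ _] := symbolic_filtration Pp.
apply: idgen_sub; first exact: symid.
move=> _ [r [c [rE _ ->]]]; apply/(symbolicP Pp).
exists ('X_ord0 ^+ i).
  rewrite /= rmorphXn /= mpoly_curve_x -exprM.
  by apply/eqP; rewrite expf_neq0 // -msupp_eq0 msuppX.
apply: (@det_rank1_mod _ _ i (mxsub r c X) 'X_ord0 (fun k => X (r k) ord0)).
  by case: Pp.
move=> k l; rewrite ![mxsub _ _ _ _ _]mxE /= rmorphB !rmorphM /=.
rewrite mpoly_curve_x !mpoly_curve_Xmat rE -!exprD /curve_weight.
by apply/eqP; rewrite subr_eq0; apply/eqP; congr (_ ^+ _); rewrite ?rE /= !mulnDl; lia.
Qed.

Lemma calI_symbolic n : I n `<=` symbolic_power (pT K e.+2 m) n.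
Proof.
apply: weighted_sum_least; first exact: (symbolic_filtration (mcurve_prime K w)).
by move=> i _; apply: calJ_symbolic.
Qed.

Let al := (egcdn e.+2 m).2.
Let de := (egcdn e.+2 m).1.
Let al_de : (de * e.+2 = al * m + 1)%N.
Proof. by rewrite /al /de; case: egcdnP => //= a b; rewrite (eqP co_dm). Qed.
Local Notation th := (theta e K al de).

Lemma theta_pR n f : symbolic_power (pR K e.+2 m) n f ->
  forall k, ord_ge n (th (wc k f)).
Proof.
have th1 := theta1 (K := K) (e := e) al de.
exact: (symbolic_ordF w_gt0 th1 (curve_prime K w_gt0)).
Qed.

Lemma theta_calI n p : I n p -> ord_ge n (th p).
Proof.
move=> /calI_symbolic/(mps_symbolic w_gt0)/theta_pR pn.
rewrite (sum_wcomp w_gt0 p) rmorph_sum.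
by apply: ideal_sum => [|i _]; [apply: ord_ge_ideal | apply: pn].
Qed.

(** The link from symbolic powers back to minors: order [n] under the deformation forces each
    component into [I n]. *)
Lemma wcomp_calI n f k : symbolic_power (pR K e.+2 m) n f -> I n (wc k f).
Proof.
move=> /theta_pR/(_ k) fk.
apply: (@calI_of_ord e m K m_gt0 th (@thetaZ e K al de) theta_calI
  (theta_surj K co_dm al_de) n k _ _ fk).
exact: wcomp_whomog.
Qed.

Lemma symbolic_pT n : symbolic_power (pT K e.+2 m) n = I n.
Proof.
apply/seteqP; split; last exact: calI_symbolic.
move=> p /(mps_symbolic w_gt0) pn; rewrite (sum_wcomp w_gt0 p).
have [Iid _ _] := calI_filtration e m K.
by apply: ideal_sum => // k _; apply: wcomp_calI.
Qed.

Lemma fg_whomog_calI n : fg_whomog w (I n).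
Proof.
apply: fg_whomog_weighted_sum => i.
pose Y := ({ffun 'I_i.+1 -> 'I_e.+2} * {ffun 'I_i.+1 -> 'I_e.+2})%type.
pose P (x : Y) := (forall k, x.1 k = k :> nat) /\
  forall k l : 'I_i.+1, (k < l)%N -> (x.2 k < x.2 l)%N.
have := @fg_whomog_fin _ K w Y P (fun x => \det (mxsub x.1 x.2 X)).
rewrite (_ : idgen _ = calJ m i); first by apply=> x _; apply: det_hom.
congr idgen; apply/seteqP; split=> [_ [x [x1 x2] ->]|_ [r [c [rE cE ->]]]].
  by exists x.1, x.2.
exists ([ffun k => r k], [ffun k => c k]).
  by split=> /= [k|k l kl]; rewrite !ffunE; auto.
by congr (\det _); apply/matrixP => k l; rewrite !mxE !ffunE.
Qed.

Lemma symbolic_pR n :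
  symbolic_power (pR K e.+2 m) n = idext (@mps_of_mpoly e.+2 K) (I n).
Proof.
apply/seteqP; split=> [f fn|].
  by apply: (idext_complete w_gt0 (fg_whomog_calI n)) => k; apply: wcomp_calI.
have [symid _ _] := symbolic_filtration (curve_prime K w_gt0).
apply: idgen_sub; first exact: symid.
by move=> _ [p /calI_symbolic pn <-]; apply: (mps_symbolic w_gt0).
Qed.

(** One inclusion holds as symbolic powers form a filtration, the other as the minors in [calJ m i]
    generating [calI] lie in the symbolic power of index [i]. *)
Lemma symbolic_pR_weighted_sum n : symbolic_power (pR K e.+2 m) n =
  weighted_sum e.+1 (fun i => if i == 1%N then pR K e.+2 m
                    else symbolic_power (pR K e.+2 m) i) n.
Proof.
have Pp := curve_prime K w_gt0; have Fs := symbolic_filtration Pp.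
set Y := fun i : nat => _.
have YE i : Y i = symbolic_power (pR K e.+2 m) i.
  by rewrite /Y; case: eqP => // ->; rewrite (symbolic1 Pp).
apply/seteqP; split; last first.
  by apply: (weighted_sum_least Fs) => i _; rewrite YE.
rewrite {1}symbolic_pR; have [Fid _ _] := weighted_sum_filtration e.+1 Y.
apply: idgen_sub; first exact: Fid.
move=> _ [p pn <-].
apply: (weighted_sum_least (preimage_filtration (@mps_of_mpoly e.+2 K)
  (weighted_sum_filtration e.+1 Y)) _ pn) => i ie f fi.
have := @weighted_sum_gen _ e.+1 Y i ie (mps_of_mpoly f); apply.
rewrite YE; apply: (mps_symbolic w_gt0); exact: calJ_symbolic.
Qed.

Lemma LI_calI n : LI ((@modx1 K e.+2) @` I n) = IT' K e.+2 n.
Proof.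
have [Iid _ _] := IT'_filtration e K.
apply/seteqP; split.
  apply: idgen_sub; first exact: Iid.
  move=> _ [_ [u [[p pI <-] [up ulead] ->]]].
  (* The weighted component of [p] containing the leading monomial stays in [I n] and keeps that
     leading monomial modulo x_1. *)
  pose k := wdeg w (emb u); pose q := wc k (mps_of_mpoly p).
  have qE x : (modx1 q)@_x = if wdeg w (emb x) == k then (modx1 p)@_x else 0.
    by rewrite !mcoeff_modx1 mcoeff_wcomp.
  have qn : I n q.
    by apply: wcomp_calI; apply: (mps_symbolic w_gt0); apply: calI_symbolic.
  apply: (@leading_mem_IT' e m K m_gt0 th (@thetaZ e K al de) theta_calI
    (theta_surj K co_dm al_de) n k q u _ (theta_calI qn)).
  - exact: wcomp_whomog.
  - by rewrite qE eqxx -mcoeff_msupp.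
  - move=> x; rewrite qE; case: ifP => [_ px xu|]; last by rewrite eqxx.
    by apply: ulead => //; rewrite mcoeff_msupp.
move=> f fn; rewrite (mpolyE f) big_seq.
have LId : is_ideal (LI ((@modx1 K e.+2) @` I n)) by exact: idgen_ideal.
apply: (@ideal_sum _ (LI ((@modx1 K e.+2) @` I n)) _ (msupp f) (fun u => u \in msupp f) (fun u => f@_u *: 'X_[u]) LId) => u uf; have [_ _ LIM] := LId.
rewrite -mul_mpolyC; apply: (LIM).
have [E EI [_ [Eu Em]]] := IT'_leadset m_gt0 fn uf.
apply: sub_idgen; exists (modx1 E), u; split=> //.
split=> [|v]; first by rewrite mcoeff_msupp.
rewrite mcoeff_msupp => /Em[dv uv] vu; right; split=> //.
by apply/ltmcP; rewrite // lt_neqAle eq_sym vu.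
Qed.

End SymbolicPowersOfCurve.

Theorem theorem6p8 (K : fieldType) (d m : nat)
    (hd : (2 <= d)%N) (hm : (1 <= m)%N) (hdm : coprime d m) :
  [/\ forall n : nat, (1 <= n)%N ->
        symbolic_power (pR K d m) n = idext (@mps_of_mpoly d K) (calI K d m n),
      forall n : nat, (d <= n)%N ->
        symbolic_power (pR K d m) n =
        weighted_sum d.-1
          (fun i => if i == 1%N then pR K d m
                    else symbolic_power (pR K d m) i) n
    & forall n : nat, (1 <= n)%N ->
        LI ((@modx1 K d) @` symbolic_power (pT K d m) n) = IT' K d n /\
        IT' K d n = LI ((@modx1 K d) @` calI K d m n)].
Proof.
case: d hd hdm => [|[|e]] // _ co; split=> n _.
- exact: symbolic_pR.
- exact: symbolic_pR_weighted_sum.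
- by rewrite symbolic_pT // LI_calI.
Qed.
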